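(* Let $M$ be an $n\times n$ Haar-distributed random orthogonal matrix and $P$ an $n\times n$ permutation matrix chosen uniformly at random from the $n!$ permutation matrices, independent of $M$. For fixed indices $a,b$, \[\sqrt{n}(MPM^T)_{ab}\xrightarrow{d}\mathcal{N}(0,1)\quad\text{as } n\to\infty.\]
   Context: Haar measure on $O(n)$ is the unique left- and right-invariant probability measure. *)

(* Defs.v *)
From HB Require Import structures.
From mathcomp Require Import all_boot all_order all_algebra all_fingroup.
From mathcomp Require Import all_classical all_reals all_analysis.
Set Implicit Arguments. Unset Strict Implicit. Unset Printing Implicit Defensive.
Import Order.TTheory GRing.Theory Num.Theory.
Local Open Scope classical_set_scope.
Local Open Scope ring_scope.

Definition orthogonal_mx {R : realType} (n : nat) (M : 'M[R]_n) : bool :=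
  M *m M^T == 1%:M.

(* Borel sigma-algebra on 'M[R]_n (= R^(n*n)): generated by the entry maps. *)
Definition mx_measurable {R : realType} (n : nat) : set (set 'M[R]_n) :=
  <<s \bigcup_(ij in [set: 'I_n * 'I_n])
        preimage_set_system setT (fun A : 'M[R]_n => A ij.1 ij.2)
          (@measurable _ R) >>.

(* M is a Haar-distributed random orthogonal matrix on the probability space
   (T, P): M is a measurable matrix-valued random variable, takes values in
   O(n) almost surely, and its law is left- and right-invariant under O(n)
   (Haar measure = unique left- and right-invariant probability on O(n)). *)
Definition haar_orthogonal_rv {d} {T : measurableType d} {R : realType}
    (P : probability T R) (n : nat) (M : T -> 'M[R]_n) : Prop :=
  [/\ forall A, mx_measurable A -> measurable (M @^-1` A),
      {ae P, forall w, orthogonal_mx (M w)} &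
      forall U : 'M[R]_n, orthogonal_mx U -> forall A, mx_measurable A ->
        P (M @^-1` A) = P ((fun w => U *m M w) @^-1` A) /\
        P (M @^-1` A) = P ((fun w => M w *m U) @^-1` A)].

Definition uniform_perm_rv {d} {T : measurableType d} {R : realType}
    (P : probability T R) (n : nat) (s : T -> {perm 'I_n}) : Prop :=
  forall p : {perm 'I_n},
    measurable [set w | s w = p] /\ P [set w | s w = p] = ((n`!)%:R^-1)%:E.

Definition indep_mx_perm {d} {T : measurableType d} {R : realType}
    (P : probability T R) (n : nat) (M : T -> 'M[R]_n) (s : T -> {perm 'I_n}) :
    Prop :=
  forall A, mx_measurable A -> forall p : {perm 'I_n},
    P (M @^-1` A `&` [set w | s w = p]) =
    (P (M @^-1` A) * P [set w | s w = p])%E.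

(* Main.v *)
Require Import Defs.
From HB Require Import structures.
From mathcomp Require Import all_boot all_order all_algebra all_fingroup.
From mathcomp Require Import all_classical all_reals all_analysis.
From mathcomp Require Import measurable_realfun.
From mathcomp Require Import ring lra.
Import Order.TTheory GRing.Theory Num.Theory.
Import numFieldNormedType.Exports.
Local Open Scope classical_set_scope.
Local Open Scope ring_scope.
Set Implicit Arguments.
Unset Strict Implicit.
Unset Printing Implicit Defensive.

(** Put [N := n.+1], [B := M P M^T] and [W := sqrt N * B_ab].  The law of the
    random orthogonal matrix [B] is invariant under conjugation, in particular
    under the rotations by the angle [t] in a coordinate plane; differentiating
    the constant expectations at [t = 0] gives exact integration by parts
    formulas.  For [a <> b], rotating in the planes [(b, c)] and summing over
    [c <> a, b] the formulas for [sqrt N * B_ac * phi(W)], the row norm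
    [sum_c B_ac^2 = 1] yields
      [N (E phi'(W) - E (W phi(W)))
         = E ((N B_aa^2 + W^2) phi'(W)) - 2 E (W phi(W))].
    For [a = b], rotating in the planes [(a, c)] yields
      [E (W phi(W)) - E phi'(W)
         = E (tr B phi(W)) / sqrt N + E (((B^2)_aa - 2 B_aa^2) phi'(W))].
    The second formula with [phi = id], applied to [B] and to [B^2], bounds the
    error terms, because [E tr P <= 1] and [E tr P^2 <= 2].  Hence
    [E (phi'(W) - W phi(W)) = O(N^(-1/2))] for every [phi] that is bounded with
    bounded continuous derivative.  Taking for [phi] the solution of Stein's
    equation [phi'(y) = y phi(y) + h(y) - E h(Z)], where [h] is a continuous
    piecewise linear approximation of the indicator function of a half-line and
    [Z] is standard normal, gives the convergence of the distribution
    functions. *)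

(** * Stein's equation *)

Section stein_equation.
Variable R : realType.
Local Notation mu := (@lebesgue_measure R).
Local Notation pdf := (@normal_pdf R 0 1).
Implicit Types t x : R.

Lemma pdf01E x : pdf x = normal_peak 1 * expR (- (x ^+ 2 / 2)).
Proof.
by rewrite normal_pdfE ?oner_eq0// /normal_fun subr0 expr1n mulNr.
Qed.

Lemma pdf01N x : pdf (- x) = pdf x.
Proof. by rewrite !pdf01E sqrrN. Qed.

Lemma is_derive_pdf01 x : is_derive x 1 pdf (- x * pdf x).
Proof.
have -> : pdf = normal_peak 1 *: (expR \o (fun x : R => - (2^-1 *: x ^+ 2))).
  by apply/funext => y; rewrite pdf01E !fctE/=; congr (_ * expR (- _)); rewrite mulrC.
apply: is_derive_eq.
rewrite ?fctE /GRing.scale /= ?fctE ?mulr1 ?expr1.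
by field.
Qed.

Lemma cvg_pdf01 : pdf x @[x --> +oo] --> (0 : R).
Proof.
rewrite (_ : pdf = fun x => normal_peak 1 * expR (- (x ^+ 2 / 2))); last first.
  by apply/funext => x; rewrite pdf01E.
rewrite -(mulr0 (normal_peak 1)); apply: cvgMr.
apply: (@squeeze_cvgr _ _ _ _ (cst 0) (fun x => expR (- x))).
(* For [x >= 2] one has [x <= x ^+ 2 / 2], so the Gaussian factor is eventually at most
   [expR (- x)]. *)
- near=> x.
  rewrite expR_ge0/= ler_expR lerN2 expr2 -mulrA ler_peMr//.
  by rewrite ler_pdivlMr// mul1r.
- exact: cvg_cst.
- exact: cvgr_expR.
Unshelve. all: end_near. Qed.

Lemma integrable_pdf01 (A : set R) : measurable A ->
  mu.-integrable A (EFin \o pdf).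
Proof. by move=> mA; apply: (integrableS measurableT) => //; exact: integrable_normal_pdf. Qed.

Lemma Rintegral_pdf01_le1 (A : set R) : measurable A ->
  \int[mu]_(x in A) pdf x <= 1.
Proof.
move=> mA.
suff : (\int[mu]_(x in A) (pdf x)%:E <= 1%:E)%E.
  move=> h; rewrite -lee_fin fineK//.
  by apply: integrable_fin_num => //; exact: integrable_pdf01.
rewrite -(integral_normal_pdf 0 1).
apply: ge0_subset_integral => //.
  by apply/measurable_EFinP; exact: measurable_normal_pdf.
by move=> x _; rewrite lee_fin normal_pdf_ge0.
Qed.

(** Mills ratio bound: on the tail [t * pdf x <= x * pdf x], and [x * pdf x] is the derivative of
    [- pdf], so its integral over the tail is exactly [pdf t]. *)
Lemma mills_right t : 0 < t -> t * \int[mu]_(x in `[t, +oo[) pdf x <= pdf t.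
Proof.
move=> t0.
have ct : continuous (fun x : R => x * pdf x).
  by move=> x; apply: cvgM; [exact: cvg_id|exact: continuous_normal_pdf].
have E : (\int[mu]_(x in `[t, +oo[) (x * pdf x)%:E = (pdf t)%:E)%E.
  rewrite (@ge0_continuous_FTC2y _ (fun x => x * pdf x) (fun x => - pdf x) t 0).
  - by rewrite sub0e EFinN oppeK.
  - by move=> x tx; rewrite mulr_ge0 ?normal_pdf_ge0// (le_trans (ltW t0)).
  - exact: continuous_subspaceT.
  - by have := cvgN cvg_pdf01; rewrite oppr0; apply.
  - move=> x _; apply: derivableN; have := is_derive_pdf01 x; by case.
  - by apply: cvgN; apply: cvg_at_right_filter; exact: continuous_normal_pdf.
  - move=> x _; rewrite derive1E deriveN; last by have := is_derive_pdf01 x; case.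
    by have := is_derive_pdf01 x => -[_ ->]; rewrite mulNr opprK.
have iA := integrable_pdf01 (measurable_itv `[t, +oo[).
rewrite -RintegralZl// -lee_fin -E fineK; last first.
  apply: integrable_fin_num => //.
  exact: (integrableZl _ _ iA).
apply: ge0_le_integral => //.
- by move=> x _; rewrite lee_fin mulr_ge0 ?normal_pdf_ge0 ?ltW.
- apply/measurable_EFinP/measurable_funTS/measurable_funM => //.
  exact: measurable_normal_pdf.
- apply/measurable_EFinP/measurable_funTS.
  exact: continuous_measurable_fun.
- by move=> x /=; rewrite in_itv/= andbT => tx; rewrite lee_fin ler_wpM2r// normal_pdf_ge0.
Qed.

Lemma mills_left t : t < 0 -> - t * \int[mu]_(x in `]-oo, t]) pdf x <= pdf t.
Proof.
move=> t0; rewrite -(pdf01N t).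
have -> : \int[mu]_(x in `]-oo, t]) pdf x = \int[mu]_(x in `[- t, +oo[) pdf x.
  rewrite /Rintegral; congr fine; rewrite -[t in LHS]opprK.
  rewrite ge0_integration_by_substitutionNy.
  - by apply: eq_integral => x _ /=; rewrite pdf01N.
  - by apply: continuous_subspaceT; exact: continuous_normal_pdf.
  - by move=> x _; rewrite normal_pdf_ge0.
by apply: mills_right; rewrite oppr_gt0.
Qed.

Section solution.
Variable h : R -> R.
Hypothesis ch : continuous h.
Hypothesis h01 : forall x, 0 <= h x <= 1.

Definition gauss_mean := \int[mu]_x (h x * pdf x).
Local Notation c := gauss_mean.

Let ihp (A : set R) (mA : measurable A) : mu.-integrable A (EFin \o (fun x => h x * pdf x)).
Proof.
apply: le_integrable (integrable_pdf01 mA) => //.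
  apply/measurable_EFinP/measurable_funTS/measurable_funM.
    exact: continuous_measurable_fun.
  exact: measurable_normal_pdf.
move=> x _ /=; rewrite lee_fin normrM ler_piMl//.
by have /andP[h0 h1] := h01 x; rewrite ger0_norm.
Qed.

Let pdf_total : \int[mu]_x pdf x = 1.
Proof. by rewrite /Rintegral integral_normal_pdf. Qed.

Let c01 : 0 <= c <= 1.
Proof.
apply/andP; split.
  apply: Rintegral_ge0 => x _; rewrite mulr_ge0 ?normal_pdf_ge0//.
  by have /andP[] := h01 x.
rewrite -pdf_total; apply: le_Rintegral => //.
- exact: ihp.
- exact: integrable_pdf01.
by move=> x _; rewrite ler_piMl ?normal_pdf_ge0//; have /andP[] := h01 x.
Qed.

Let g x := (h x - c) * pdf x.

Let hc1 x : `|h x - c| <= 1.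
Proof.
by have /andP[h0 h1] := h01 x; have /andP[c0 c1] := c01; rewrite ler_norml; lra.
Qed.

Let cg : continuous g.
Proof.
move=> x; apply: cvgM; last exact: continuous_normal_pdf.
by apply: cvgB; [exact: ch|exact: cvg_cst].
Qed.

Let ig (A : set R) (mA : measurable A) : mu.-integrable A (EFin \o g).
Proof.
apply: le_integrable (integrable_pdf01 mA) => //.
  by apply/measurable_EFinP/measurable_funTS; exact: continuous_measurable_fun cg.
by move=> x _ /=; rewrite lee_fin normrM ler_piMl.
Qed.

Let g_total : \int[mu]_x g x = 0.
Proof.
rewrite /g; under eq_Rintegral do rewrite mulrBl.
rewrite RintegralB//.
- rewrite RintegralZl//; last exact: integrable_pdf01.
  by rewrite pdf_total mulr1 subrr.
- exact: ihp.
- exact: (integrableZl _ _ (integrable_pdf01 measurableT)).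
Qed.

Let F x := \int[mu]_(t in `]-oo, x]) g t.

Let g_le (A : set R) : measurable A -> `|\int[mu]_(x in A) g x| <= \int[mu]_(x in A) pdf x.
Proof.
move=> mA; apply: le_trans (le_normr_Rintegral _ _) _ => //; first exact: ig.
apply: le_Rintegral => //.
- exact: integrable_norm (ig mA).
- exact: integrable_pdf01.
move=> x _; rewrite normrM [X in _ * X]ger0_norm ?normal_pdf_ge0//.
by rewrite ler_piMl ?normal_pdf_ge0.
Qed.

Let F_le1 x : `|F x| <= 1.
Proof. by apply: (le_trans (g_le _)) => //; exact: Rintegral_pdf01_le1. Qed.

Let xF x : `|x * F x| <= pdf x.
Proof.
rewrite normrM; have [x0|x0|->] := ltgtP x 0.
- rewrite (le_trans _ (mills_left x0))// ltr0_norm//.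
  by apply: ler_wpM2l; [rewrite oppr_ge0 ltW|exact: g_le].
- rewrite (le_trans _ (mills_right x0))// gtr0_norm//.
  apply: ler_wpM2l; first exact: ltW.
  (* Since [g] has total integral zero, [F x] is also minus the right tail, and the right-hand Mills
     bound applies. *)
  have -> : F x = - \int[mu]_(t in `]x, +oo[) g t.
    rewrite -(@Rintegral_itvB _ g -oo%O +oo%O x)//; last exact: ig.
    by rewrite set_itvNyy g_total sub0r opprK.
  rewrite normrN Rintegral_itv_obnd_cbnd; last exact: ig.
  exact: g_le.
- by rewrite normr0 mul0r normal_pdf_ge0.
Qed.

(** The reciprocal of the density, which is the integrating factor of Stein's equation because
    [q' = x * q]. *)
Let q x := (normal_peak 1)^-1 * expR (2^-1 * x ^+ 2) : R.

Let pq x : pdf x * q x = 1.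
Proof.
rewrite pdf01E /q mulrACA divff ?gt_eqF ?normal_peak_gt0 ?oner_eq0//.
by rewrite mul1r -expRD (mulrC 2^-1) addNr expR0.
Qed.

Let q_ge0 x : 0 <= q x.
Proof. by rewrite mulr_ge0 ?expR_ge0// invr_ge0 normal_peak_ge0. Qed.

Let dq x : is_derive x 1 q (x * q x).
Proof.
have -> : q = (normal_peak 1)^-1 *: (expR \o (fun x : R => (2^-1 *: x ^+ 2))).
  by [].
apply: is_derive_eq.
rewrite ?fctE /GRing.scale /= ?fctE ?mulr1 ?expr1.
by field; rewrite gt_eqF// normal_peak_gt0// oner_eq0.
Qed.

Let dF x : is_derive x 1 F (g x).
Proof.
have x1 : x < x + 1 by rewrite ltrDl.
have [d e] := @continuous_FTC1 R g -oo%O x (x + 1) x1 (ig (measurable_itv _))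
  (ltNyr _) (@cg x).
by apply: DeriveDef => //; rewrite -e derive1E.
Qed.

Lemma stein_solution : exists f : R -> R, exists K : R,
  [/\ forall x, is_derive x 1 f (x * f x + (h x - c)),
      forall x, `|f x| <= K & forall x, `|x * f x + (h x - c)| <= K].
Proof.
(* Variation of constants: [F' = (h - c) * pdf] and [pdf * q = 1]. The solution is at most 1 when
   [|x| >= 1], by the bound on [x * f x], and at most [q 1] when [|x| < 1]; its derivative is at
   most [1 + 1]. *)
exists (F * q), (2 + q 1).
have xf x : `|x * (F x * q x)| <= 1.
  rewrite mulrA normrM (ger0_norm (q_ge0 x)) -(pq x) ler_wpM2r//.
split=> x.
- apply: is_derive_eq (is_deriveM (dF x) (dq x)) _; rewrite !fctE /GRing.scale/=.
  rewrite /g; have := pq x; move: (pdf x) (q x) (F x) => p' q' F' e.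
  transitivity (x * (F' * q') + (h x - c) * (p' * q')); first by ring.
  by rewrite e mulr1.
- have [x1|x1] := leP 1 `|x|.
    apply: (@le_trans _ _ 1); last by rewrite -[leLHS]addr0 lerD// ler1n.
    by apply: le_trans (xf x); rewrite [leRHS]normrM ler_peMl.
  rewrite !fctE normrM (ger0_norm (q_ge0 x)).
  apply: (@le_trans _ _ (q 1)); last by rewrite lerDr.
  apply: (@le_trans _ _ (q x)); first by rewrite ler_piMl.
  rewrite /q ler_wpM2l ?invr_ge0 ?normal_peak_ge0// ler_expR ler_wpM2l ?invr_ge0//.
  by rewrite expr1n -real_normK ?num_real// expr_le1// ltW.
- apply: (le_trans (ler_normD _ _)).
  have := xf x; have := hc1 x; have := q_ge0 1; rewrite /= !fctE; lra.
Qed.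

End solution.
End stein_equation.

(** * Bounded random variables *)

Section calculus.
Variable R : realType.

Lemma is_derive_continuous (f df : R -> R) :
  (forall x : R, is_derive x 1 f (df x)) -> continuous f.
Proof.
move=> fdf x; apply: differentiable_continuous; apply/derivable1_diffP.
by have [] := fdf x.
Qed.

Lemma continuous_bounded_on_segment (f : R -> R) (K : R) : continuous f ->
  exists C : R, forall x, `|x| <= K -> `|f x| <= C.
Proof.
move=> cf; have [C [_ hC]] : bounded_set (f @` `[- K, K]).
  apply: compact_bounded; apply: continuous_compact; last exact: segment_compact.
  exact: continuous_subspaceT.
(* [bounded_set] provides a bound by every number strictly above [C], hence the shift by 1. *)
exists (C + 1) => x xK; apply: (hC (C + 1)); first by rewrite ltrDl.
by exists x => //=; rewrite in_itv /= -ler_norml.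
Qed.

End calculus.

Section bounded_random_variables.
Context {d : measure_display} {T : measurableType d} {R : realType}.
Variable P : probability T R.
Implicit Types f g : T -> R.

(** A class of integrable functions closed under ring operations and continuous maps. Entries of
    orthogonal matrices are bounded by 1, so every random variable whose expectation is computed
    below belongs to it and integrability becomes a structural check. *)
Definition bmf f := measurable_fun setT f /\ exists K : R, forall x, `|f x| <= K.

Lemma bmf_integrable f : bmf f -> P.-integrable setT (EFin \o f).
Proof.
move=> [mf [K fK]]; apply: measurable_bounded_integrable => //.
  by rewrite (le_lt_trans (probability_le1 _ _))// ltry.
exists K; split; first exact: num_real.
by move=> x Kx t _; exact: le_trans (fK t) (ltW Kx).
Qed.

Lemma bmf_cst (c : R) : bmf (fun=> c).
Proof. by split; [exact: measurable_cst|exists `|c|]. Qed.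

Lemma bmfD f g : bmf f -> bmf g -> bmf (fun w => f w + g w).
Proof.
move=> [mf [K fK]] [mg [L gL]]; split; first exact: measurable_funD.
by exists (K + L) => x; rewrite (le_trans (ler_normD _ _))// lerD.
Qed.

Lemma bmfM f g : bmf f -> bmf g -> bmf (fun w => f w * g w).
Proof.
move=> [mf [K fK]] [mg [L gL]]; split; first exact: measurable_funM.
by exists (K * L) => x; rewrite normrM ler_pM.
Qed.

Lemma bmfN f : bmf f -> bmf (fun w => - f w).
Proof.
move=> [mf [K fK]]; split; first exact: measurableT_comp.
by exists K => x; rewrite normrN.
Qed.

Lemma bmfB f g : bmf f -> bmf g -> bmf (fun w => f w - g w).
Proof. by move=> bf bg; apply: bmfD => //; exact: bmfN. Qed.

Lemma bmfX f n : bmf f -> bmf (fun w => f w ^+ n).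
Proof.
move=> bf; elim: n => [|n ih]; first exact: bmf_cst.
by under eq_fun do rewrite exprS; exact: bmfM.
Qed.

Lemma bmf_norm f : bmf f -> bmf (fun w => `|f w|).
Proof.
move=> [mf [K fK]]; split; first exact: measurableT_comp.
by exists K => x; rewrite normr_id.
Qed.

Lemma bmf_sum (I : Type) (r : seq I) (Q : pred I) (F : I -> T -> R) :
  (forall i, bmf (F i)) -> bmf (fun w => \sum_(i <- r | Q i) F i w).
Proof.
move=> bF; elim: r => [|i r ih].
  by under eq_fun do rewrite big_nil; exact: bmf_cst.
under eq_fun do rewrite big_cons; case: (Q i) => //.
exact: bmfD.
Qed.

Lemma bmf_comp (phi : R -> R) f : continuous phi -> bmf f ->
  bmf (fun w => phi (f w)).
Proof.
move=> cphi [mf [K fK]]; split.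
  by apply: measurableT_comp => //; exact: continuous_measurable_fun.
have [C hC] := continuous_bounded_on_segment K cphi.
by exists C => x; exact: hC.
Qed.

Definition Ex f := \int[P]_w f w.

Lemma ExD f g : bmf f -> bmf g -> Ex (fun w => f w + g w) = Ex f + Ex g.
Proof. by move=> bf bg; rewrite /Ex RintegralD//; exact: bmf_integrable. Qed.

Lemma ExB f g : bmf f -> bmf g -> Ex (fun w => f w - g w) = Ex f - Ex g.
Proof. by move=> bf bg; rewrite /Ex RintegralB//; exact: bmf_integrable. Qed.

Lemma ExZ (c : R) f : bmf f -> Ex (fun w => c * f w) = c * Ex f.
Proof. by move=> bf; rewrite /Ex RintegralZl//; exact: bmf_integrable. Qed.

Lemma Ex_cst (c : R) : Ex (fun=> c) = c.
Proof. by rewrite /Ex Rintegral_cst// [X in fine X]probability_setT mulr1. Qed.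

Lemma Ex_sum (I : Type) (r : seq I) (Q : pred I) (F : I -> T -> R) :
  (forall i, bmf (F i)) ->
  Ex (fun w => \sum_(i <- r | Q i) F i w) = \sum_(i <- r | Q i) Ex (F i).
Proof.
move=> bF; elim: r => [|i r ih].
  by rewrite big_nil; under [in LHS]eq_fun do rewrite big_nil; exact: Ex_cst.
rewrite big_cons; under [in LHS]eq_fun do rewrite big_cons.
by case: (Q i) => //; rewrite ExD// ?ih//; exact: bmf_sum.
Qed.

Lemma le_Ex f g : bmf f -> bmf g -> (forall w, f w <= g w) -> Ex f <= Ex g.
Proof. by move=> bf bg fg; apply: le_Rintegral => //; exact: bmf_integrable. Qed.

Lemma Ex_ge0 f : (forall w, 0 <= f w) -> 0 <= Ex f.
Proof. by move=> f0; apply: Rintegral_ge0. Qed.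

Lemma le_norm_Ex f : bmf f -> `|Ex f| <= Ex (fun w => `|f w|).
Proof. by move=> bf; apply: le_normr_Rintegral => //; exact: bmf_integrable. Qed.

Lemma Ex_indic (A : set T) : measurable A -> Ex (\1_A) = fine (P A).
Proof. by move=> mA; rewrite /Ex /Rintegral integral_indic// setIT. Qed.

Lemma bmf_indic (A : set T) : measurable A -> bmf (\1_A : T -> R).
Proof.
move=> mA; split; first exact: measurable_indic.
by exists 1 => x; rewrite indicE ger0_norm// lern1 leq_b1.
Qed.

End bounded_random_variables.

(** * Measurability of matrix-valued maps *)

Section matrix_measurability.
Context {R : realType} (n : nat).

(** A copy of the matrix type that carries the sigma-algebra of [mx_measurable] as a canonical
    structure, so that [measurable_fun] and [pushforward] apply to random matrices. *)
Definition mxtype := g_sigma_algebraType (\bigcup_(ij in [set: 'I_n * 'I_n])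
  preimage_set_system setT (fun A : 'M[R]_n => A ij.1 ij.2) (@measurable _ R)).

HB.instance Definition _ := Measurable.on mxtype.

Lemma measurable_entry (i j : 'I_n) :
  measurable_fun setT (fun A : mxtype => A i j).
Proof.
move=> _ Y mY; rewrite setTI; apply: sub_sigma_algebra.
by exists (i, j) => //; exists Y => //; rewrite setTI.
Qed.

Lemma measurable_mx (d : measure_display) (T : measurableType d)
    (A : T -> mxtype) :
  (forall i j, measurable_fun setT (fun w => A w i j)) ->
  measurable_fun setT A.
Proof.
move=> mA.
apply: measurability; first by [].
move=> _ [_ [[i j] _ [Y mY <-]] <-].
have := mA i j measurableT Y mY; rewrite !setTI //.
Qed.

Lemma measurable_mulmx (d : measure_display) (T : measurableType d)
    (A B : T -> mxtype) : measurable_fun setT A -> measurable_fun setT B ->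
  measurable_fun setT (fun w => A w *m B w : mxtype).
Proof.
move=> mA mB; apply: measurable_mx => i j.
under eq_fun do rewrite mxE.
apply: measurable_sum => k; apply: measurable_funM.
  exact: (measurableT_comp (measurable_entry i k)).
exact: (measurableT_comp (measurable_entry k j)).
Qed.

Lemma measurable_trmx (d : measure_display) (T : measurableType d)
    (A : T -> mxtype) : measurable_fun setT A ->
  measurable_fun setT (fun w => (A w)^T : mxtype).
Proof.
move=> mA; apply: measurable_mx => i j; under eq_fun do rewrite mxE.
exact: (measurableT_comp (measurable_entry j i)).
Qed.

End matrix_measurability.
Arguments mxtype : clear implicits.

(** * Plane rotations *)

Section orthogonal_matrices.
Context {R : realType} (n : nat).
Implicit Types A B : 'M[R]_n.

Lemma orthogonal_trr A : orthogonal_mx A -> A *m A^T = 1%:M.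
Proof. by move/eqP. Qed.

Lemma orthogonal_trl A : orthogonal_mx A -> A^T *m A = 1%:M.
Proof. by move/eqP/mulmx1C. Qed.

Lemma orthogonalM A B : orthogonal_mx A -> orthogonal_mx B ->
  orthogonal_mx (A *m B).
Proof.
move=> /orthogonal_trr oA /orthogonal_trr oB; apply/eqP.
by rewrite trmx_mul mulmxA -(mulmxA A) oB mulmx1.
Qed.

Lemma orthogonalT A : orthogonal_mx A -> orthogonal_mx A^T.
Proof. by move=> /orthogonal_trl oA; apply/eqP; rewrite trmxK. Qed.

Lemma orthogonal_perm (p : {perm 'I_n}) : orthogonal_mx (perm_mx p : 'M[R]_n).
Proof.
by apply/eqP; rewrite tr_perm_mx -perm_mxM mulgV perm_mx1.
Qed.

Lemma orthogonal_row_norm A i : orthogonal_mx A -> \sum_j A i j ^+ 2 = 1.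
Proof.
move=> /orthogonal_trr /matrixP/(_ i i); rewrite !mxE eqxx mulr1n => <-.
by apply: eq_bigr => j _; rewrite mxE expr2.
Qed.

Lemma orthogonal_entry_le1 A i j : orthogonal_mx A -> `|A i j| <= 1.
Proof.
move=> /(orthogonal_row_norm i) e.
rewrite -(@expr_le1 _ 2)// real_normK ?num_real// -e (bigD1 j)//=.
by rewrite lerDl sumr_ge0// => k _; exact: sqr_ge0.
Qed.

End orthogonal_matrices.

Section rotations.
Context {R : realType} (n : nat) (i j : 'I_n).
Hypothesis ij : i != j.

Let D : 'M[R]_n := delta_mx i i + delta_mx j j.
Let J : 'M[R]_n := delta_mx i j - delta_mx j i.

(** This is the exponential of [t *: J]: [J] generates the rotations of the plane [(i, j)] and
    [J *m J = - D], where [D] projects onto that plane. In this form the group law follows from the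
    four products of [D] and [J] and the addition formulas. *)
Definition rot (t : R) : 'M[R]_n := 1%:M + (cos t - 1) *: D + sin t *: J.

Let ji : (j == i) = false.
Proof. by rewrite eq_sym (negbTE ij). Qed.

Let DD : D *m D = D.
Proof.
rewrite /D !(mulmxDl, mulmxDr) !mul_delta_mx_cond !eqxx (negbTE ij) ji.
by rewrite !mulr0n !mulr1n ?(addr0, add0r, subr0, sub0r) ?opprD 1?addrC.
Qed.

Let DJ : D *m J = J.
Proof.
rewrite /D /J !(mulmxDl, mulmxBr) !mul_delta_mx_cond !eqxx (negbTE ij) ji.
by rewrite !mulr0n !mulr1n ?(addr0, add0r, subr0, sub0r) ?opprD 1?addrC.
Qed.

Let JD : J *m D = J.
Proof.
rewrite /D /J !(mulmxBl, mulmxDr) !mul_delta_mx_cond !eqxx (negbTE ij) ji.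
by rewrite !mulr0n !mulr1n ?(addr0, add0r, subr0, sub0r) ?opprD 1?addrC.
Qed.

Let JJ : J *m J = - D.
Proof.
rewrite /D /J !(mulmxBl, mulmxBr) !mul_delta_mx_cond !eqxx (negbTE ij) ji.
by rewrite !mulr0n !mulr1n ?(addr0, add0r, subr0, sub0r) ?opprD 1?addrC.
Qed.

Let DT : D^T = D.
Proof. by rewrite /D linearD/= !trmx_delta. Qed.

Let JT : J^T = - J.
Proof. by rewrite /J linearB/= !trmx_delta opprB. Qed.

Lemma rotD s t : rot (s + t) = rot s *m rot t.
Proof.
rewrite /rot cosD sinD; move: D J DD DJ JD JJ => D' J' dd dj jd jj.
rewrite !(mulmxDl, mulmxDr, mul1mx, mulmx1) -!(scalemxAl, scalemxAr).
rewrite dd dj jd jj.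
by apply/matrixP => x y; rewrite !mxE; ring.
Qed.

Lemma rot0 : rot 0 = 1%:M.
Proof. by rewrite /rot cos0 sin0 subrr !scale0r !addr0. Qed.

Lemma trmx_rot t : (rot t)^T = rot (- t).
Proof.
rewrite /rot cosN sinN; move: D J DT JT => D' J' dt jt.
by rewrite !linearD/= !linearZ/= dt jt trmx1 scalerN scaleNr.
Qed.

Lemma orthogonal_rot t : orthogonal_mx (rot t).
Proof. by apply/eqP; rewrite trmx_rot -rotD subrr rot0. Qed.

Let delta_mulE (k l : 'I_n) m (C : 'M[R]_(n, m)) x y :
  (delta_mx k l *m C) x y = (x == k)%:R * C l y.
Proof.
rewrite mxE (bigD1 l)//= mxE eqxx andbT big1 ?addr0// => z zl.
by rewrite mxE (negbTE zl) andbF mul0r.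
Qed.

Let rotE t m (C : 'M[R]_(n, m)) x y : (rot t *m C) x y =
  C x y + (cos t - 1) * ((x == i)%:R * C i y + (x == j)%:R * C j y)
  + sin t * ((x == i)%:R * C j y - (x == j)%:R * C i y).
Proof.
rewrite /rot /D /J !mulmxDl -!scalemxAl mulmxDl mulmxBl mul1mx.
move: (delta_mulE i i C x y) (delta_mulE i j C x y) (delta_mulE j i C x y).
move: (delta_mulE j j C x y).
move: (delta_mx _ _ *m C) (delta_mx _ _ *m C) (delta_mx _ _ *m C) (delta_mx _ _ *m C).
by move=> M1 M2 M3 M4 e1 e2 e3 e4; rewrite !mxE e1 e2 e3 e4.
Qed.

Definition rconj t (C : 'M[R]_n) := rot t *m C *m (rot t)^T.

Lemma rconj0 C : rconj 0 C = C.
Proof. by rewrite /rconj rot0 trmx1 mulmx1 mul1mx. Qed.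

Lemma rconjD s t C : rconj (s + t) C = rconj s (rconj t C).
Proof. by rewrite /rconj rotD trmx_mul !mulmxA. Qed.

Lemma orthogonal_rconj t C : orthogonal_mx C -> orthogonal_mx (rconj t C).
Proof.
move=> oC; apply: orthogonalM; first by apply: orthogonalM => //; exact: orthogonal_rot.
exact: orthogonalT (orthogonal_rot _).
Qed.

Let rconjE t C x y : rconj t C x y =
  (rot t *m C) x y + (cos t - 1) *
    ((y == i)%:R * (rot t *m C) x i + (y == j)%:R * (rot t *m C) x j)
  + sin t * ((y == i)%:R * (rot t *m C) x j - (y == j)%:R * (rot t *m C) x i).
Proof.
(* Transposing turns the right multiplication into a left one, so that [rotE] can be used twice. *)
have -> : rconj t C x y = (rot t *m (rot t *m C)^T) y x.
  by rewrite -[in RHS](trmxK (rot t)) -trmx_mul [RHS]mxE trmxK.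
by rewrite rotE; do !rewrite [(_^T) _ _]mxE.
Qed.

Lemma rconj_xi t C x : x != i -> x != j ->
  rconj t C x i = cos t * C x i + sin t * C x j.
Proof.
move=> /negbTE xi /negbTE xj; rewrite rconjE !rotE xi xj eqxx ?(negbTE ij) ?ji ?mulr1n ?mulr0n; ring.
Qed.

Lemma rconj_xj t C x : x != i -> x != j ->
  rconj t C x j = cos t * C x j - sin t * C x i.
Proof.
move=> /negbTE xi /negbTE xj; rewrite rconjE !rotE xi xj eqxx ?(negbTE ij) ?ji ?mulr1n ?mulr0n; ring.
Qed.

Lemma rconj_ii t C : rconj t C i i =
  cos t ^+ 2 * C i i + cos t * sin t * (C i j + C j i) + sin t ^+ 2 * C j j.
Proof. by rewrite rconjE !rotE !eqxx ?(negbTE ij) ?ji ?mulr1n ?mulr0n; ring. Qed.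

Lemma rconj_ij t C : rconj t C i j =
  cos t ^+ 2 * C i j + cos t * sin t * (C j j - C i i) - sin t ^+ 2 * C j i.
Proof. by rewrite rconjE !rotE !eqxx ?(negbTE ij) ?ji ?mulr1n ?mulr0n; ring. Qed.

Lemma rconj_ji t C : rconj t C j i =
  cos t ^+ 2 * C j i + cos t * sin t * (C j j - C i i) - sin t ^+ 2 * C i j.
Proof. by rewrite rconjE !rotE !eqxx ?(negbTE ij) ?ji ?mulr1n ?mulr0n; ring. Qed.

End rotations.

(** * Integration by parts *)

Section integration_by_parts.
Context {d : measure_display} {T : measurableType d} {R : realType}.
Variables (P : probability T R) (n : nat).
Local Notation mxT := (mxtype R n).
Implicit Types (B : T -> 'M[R]_n) (C : 'M[R]_n).

(** What the Stein argument retains of [M P M^T]. Orthogonality is required at every point, not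
    almost surely, so that functions bounded on the orthogonal group give members of [bmf]. *)
Definition conj_invariant B :=
  [/\ measurable_fun setT (B : T -> mxT), forall w, orthogonal_mx (B w) &
      forall U, orthogonal_mx U -> forall A, mx_measurable A ->
        P (B @^-1` A) = P ((fun w => U *m B w *m U^T) @^-1` A)].

Variable B : T -> 'M[R]_n.
Hypothesis BB : conj_invariant B.

Let mB : measurable_fun setT (B : T -> mxT). Proof. by case: BB. Qed.
Let oB w : orthogonal_mx (B w). Proof. by case: BB. Qed.

Lemma measurable_fixed_conj (U : 'M[R]_n) :
  measurable_fun setT (fun w => U *m B w *m U^T : mxT).
Proof.
have mU : measurable_fun setT ((fun=> U) : T -> mxT) by exact: measurable_cst.
exact: (measurable_mulmx (measurable_mulmx mU mB) (measurable_trmx mU)).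
Qed.

Definition bounded_on_orthogonal (G : 'M[R]_n -> R) :=
  exists K : R, forall C, orthogonal_mx C -> `|G C| <= K.

Lemma bmf_mx (G : mxT -> R) (A : T -> 'M[R]_n) :
  measurable_fun setT G -> measurable_fun setT (A : T -> mxT) ->
  bounded_on_orthogonal G -> (forall w, orthogonal_mx (A w)) ->
  bmf (fun w => G (A w)).
Proof.
move=> mG mA [K GK] oA; split; first exact: (measurableT_comp mG mA).
by exists K => w; exact: GK.
Qed.

Lemma orthogonal_conj U C : orthogonal_mx U -> orthogonal_mx C ->
  orthogonal_mx (U *m C *m U^T).
Proof.
by move=> oU oC; apply: orthogonalM; [exact: orthogonalM|exact: orthogonalT].
Qed.

(** Both expectations are integrals of [G] against push-forwards of [P], and invariance says that
    these two laws coincide. *)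
Lemma Ex_conj (G : mxT -> R) U : measurable_fun setT G ->
  bounded_on_orthogonal G -> orthogonal_mx U ->
  Ex P (fun w => G (U *m B w *m U^T)) = Ex P (fun w => G (B w)).
Proof.
move=> mG bG oU.
have mU := measurable_fixed_conj U.
have mEG : measurable_fun setT (EFin \o G) by exact/measurable_EFinP.
have i1 : P.-integrable setT ((EFin \o G) \o (B : T -> mxT)).
  exact: bmf_integrable (bmf_mx mG mB bG oB).
have i2 : P.-integrable setT ((EFin \o G) \o (fun w => U *m B w *m U^T : mxT)).
  apply: bmf_integrable (bmf_mx mG mU bG _) => w; exact: orthogonal_conj.
rewrite /Ex /Rintegral; congr fine.
transitivity (\int[pushforward P (fun w => U *m B w *m U^T : mxT)]_y (G y)%:E)%E.
  by rewrite integral_pushforward.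
transitivity (\int[pushforward P (B : T -> mxT)]_y (G y)%:E)%E; last first.
  by rewrite integral_pushforward.
apply: eq_measure_integral => A mA _.
by case: BB => _ _ /(_ U oU A mA) h; rewrite /pushforward; exact: esym h.
Qed.

Variables (i j : 'I_n).
Hypothesis ij : i != j.

(* The law of [B] is fixed by every rotation, so the expectation of [G] along
   the rotation flow is constant and its derivative at [0] vanishes. *)
Lemma Ex_rotation_derivative (G DG : 'M[R]_n -> R) :
  measurable_fun setT (G : mxT -> R) ->
  bounded_on_orthogonal G -> bounded_on_orthogonal DG ->
  (forall C, orthogonal_mx C ->
    is_derive (0 : R) 1 (fun t : R => G (rconj i j t C)) (DG C)) ->
  Ex P (fun w => DG (B w)) = 0.
Proof.
move=> mG bG [K DGK] dG.
(* By the group law of the flow, the derivative at time [t] is the derivative at time 0 started from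
   the rotated matrix. *)
have dGt (C : 'M[R]_n) (t : R) : orthogonal_mx C ->
    is_derive t 1 (fun t : R => G (rconj i j t C)) (DG (rconj i j t C)).
  move=> oC.
  have -> : (fun s : R => G (rconj i j s C)) =
      (fun s : R => G (rconj i j s (rconj i j t C))) \o (fun s : R => s - t).
    by apply/funext => s /=; rewrite -rconjD// subrK.
  have h : is_derive (t - t) 1 (fun s : R => G (rconj i j s (rconj i j t C)))
     (DG (rconj i j t C)).
    by rewrite subrr; apply: dG; exact: orthogonal_rconj.
  have h2 : is_derive t 1 (fun s : R => s - t) (1 - 0).
    exact: is_deriveB.
  have hc := @is_derive1_comp R _ (fun s : R => s - t) t _ _ h h2.
  by apply: is_derive_eq hc _; rewrite subr0 mulr1.
(* Differentiation under the integral on a neighbourhood of 0, with the constant [|K|] as dominating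
   function. *)
have I0 : `]-1, 1[%classic (0 : R) by rewrite /= in_itv /= ltrN10 ltr01.
pose f (t : R) w := G (rconj i j t (B w)).
have intf t : `]-1, 1[%classic t -> P.-integrable setT (EFin \o f t).
  move=> _; apply: bmf_integrable; apply: bmf_mx mG _ bG _.
    exact: measurable_fixed_conj.
  by move=> w; exact: orthogonal_rconj.
have derf t w : `]-1, 1[%classic t -> setT w -> derivable (f ^~ w) t 1.
  by move=> _ _; have [] := dGt _ t (oB w).
have d1f t w : partial1of2 f t w = DG (rconj i j t (B w)).
  by rewrite partial1of2E; have [] := dGt _ t (oB w).
have K0 : 0 <= `|K| by [].
have iK : P.-integrable setT (EFin \o (fun=> `|K|)).
  exact: bmf_integrable (bmf_cst _).
have fK t w : `]-1, 1[%classic t -> setT w -> `|partial1of2 f t w| <= `|K|.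
  move=> _ _; rewrite d1f (le_trans (DGK _ _)) ?ler_norm//.
  exact: orthogonal_rconj.
have := @cvg_differentiation_under_integral R _ T P f setT measurableT 0 (-1) 1
   I0 intf derf (fun=> `|K|) (fun=> K0) iK fK.
(* Every difference quotient of the expectations is zero, by invariance. *)
rewrite [X in X @ _ --> _](_ : _ = fun=> 0); last first.
  apply/funext => h; have e t : \int[P]_y f t y = Ex P (fun w => G (B w)).
    exact: (Ex_conj mG bG (orthogonal_rot ij t)).
  by rewrite !e subrr scaler0.
move=> c; have := @cvg_unique _ _ _ _ _ _ c (cvg_cst 0) => e.
transitivity (\int[P]_y partial1of2 f 0 y); last by apply: e.
by apply: eq_Rintegral => w _; rewrite d1f rconj0.
Qed.

(** The product and chain rules for [L1 * phi(L2)] along the flow. As [L2] is bounded on the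
    orthogonal group, [phi] and [dphi] need bounds only on a segment, which admits [phi = id]. *)
Lemma Ex_rotation_product (L1 L2 D1 D2 : 'M[R]_n -> R) (phi dphi : R -> R) :
  measurable_fun setT (L1 : mxT -> R) -> measurable_fun setT (L2 : mxT -> R) ->
  bounded_on_orthogonal L1 -> bounded_on_orthogonal L2 ->
  bounded_on_orthogonal D1 -> bounded_on_orthogonal D2 ->
  (forall C, is_derive (0 : R) 1 (fun t : R => L1 (rconj i j t C)) (D1 C)) ->
  (forall C, is_derive (0 : R) 1 (fun t : R => L2 (rconj i j t C)) (D2 C)) ->
  (forall x : R, is_derive x 1 phi (dphi x)) -> continuous dphi ->
  Ex P (fun w => D1 (B w) * phi (L2 (B w)) +
                 L1 (B w) * (dphi (L2 (B w)) * D2 (B w))) = 0.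
Proof.
move=> m1 m2 [K1 b1] [K2 b2] [K3 b3] [K4 b4] d1 d2 dp cdp.
have cp := is_derive_continuous dp.
have [Kp hKp] := continuous_bounded_on_segment K2 cp.
have [Kd hKd] := continuous_bounded_on_segment K2 cdp.
apply: (@Ex_rotation_derivative (fun C => L1 C * phi (L2 C))
  (fun C => D1 C * phi (L2 C) + L1 C * (dphi (L2 C) * D2 C))).
- apply: measurable_funM => //; apply: measurableT_comp => //.
  exact: continuous_measurable_fun.
- exists (K1 * Kp) => C oC; rewrite normrM ler_pM ?b1//.
  by apply: hKp; exact: b2.
- exists (K3 * Kp + K1 * (Kd * K4)) => C oC.
  rewrite (le_trans (ler_normD _ _))// !normrM lerD//.
    by rewrite ler_pM ?b3// hKp// b2.
  by rewrite ler_pM ?b1// ?mulr_ge0// ler_pM ?b4// hKd// b2.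
- move=> C oC.
  have h2 := d2 C.
  have hp : is_derive (L2 (rconj i j 0 C)) 1 phi (dphi (L2 C)).
    by rewrite rconj0; exact: dp.
  have hc := is_derive1_comp hp h2.
  apply: is_derive_eq (is_deriveM (d1 C) hc) _.
  by rewrite /= !rconj0 /GRing.scale /=; ring.
Qed.

End integration_by_parts.

Ltac bmf_tac := repeat first [ solve [eauto 2] | exact: bmf_cst
  | apply: bmfB | apply: bmfD | apply: bmfM | apply: bmfN | apply: bmfX | apply: bmf_norm
  | apply: bmf_sum => ? | by apply: bmf_comp => // ].

(** Entries with exactly one index in the plane of rotation vary in this way with the angle; those
    with both indices in it vary as in [is_derive_trig2]. *)
Lemma is_derive_trig1 (R : realType) (p q : R) :
  is_derive (0 : R) 1 (fun t : R => cos t * p + sin t * q) q.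
Proof.
have -> : (fun t : R => cos t * p + sin t * q) = p *: cos + q *: sin.
  by apply/funext => t; rewrite !fctE /GRing.scale /=; ring.
by apply: is_derive_eq; rewrite sin0 cos0 /GRing.scale /=; ring.
Qed.

Lemma is_derive_trig2 (R : realType) (p q r : R) :
  is_derive (0 : R) 1
    (fun t : R => cos t ^+ 2 * p + cos t * sin t * q + sin t ^+ 2 * r) q.
Proof.
have -> : (fun t : R => cos t ^+ 2 * p + cos t * sin t * q + sin t ^+ 2 * r) =
    p *: cos ^+ 2 + q *: (cos * sin) + r *: sin ^+ 2.
  by apply/funext => t; rewrite !fctE /GRing.scale /=; ring.
by apply: is_derive_eq; rewrite ?fctE sin0 cos0 /GRing.scale /=; ring.
Qed.

(** * Exact Stein identities for the entries of an invariant matrix *)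

Section stein_identities.
Context {d : measure_display} {T : measurableType d} {R : realType}.
Variables (P : probability T R) (n : nat).
Local Notation mxT := (mxtype R n).
Local Notation N := (n%:R : R).
Local Notation rN := (Num.sqrt (n%:R : R)).
Local Notation E := (Ex P).

Let rN2 : rN * rN = N.
Proof. by rewrite -expr2 sqr_sqrtr. Qed.

Section fixed_matrix.
Variable B : T -> 'M[R]_n.
Hypothesis BB : conj_invariant P B.

Let mB : measurable_fun setT (B : T -> mxT). Proof. by case: BB. Qed.
Let oB w : orthogonal_mx (B w). Proof. by case: BB. Qed.

Let mE (x y : 'I_n) : measurable_fun setT (fun C : mxT => C x y).
Proof. exact: measurable_entry. Qed.

Lemma bmf_entry x y : bmf (fun w => B w x y).
Proof.
apply: bmf_mx (mE x y) mB _ oB; exists 1 => C; exact: orthogonal_entry_le1.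
Qed.

Lemma bmf_mxtrace : bmf (fun w => \tr (B w)).
Proof. by rewrite /mxtrace; apply: bmf_sum => x; exact: bmf_entry. Qed.

Section offdiag.
Variables (a b : 'I_n) (phi dphi : R -> R).
Hypothesis ab : a != b.
Hypothesis dp : forall x : R, is_derive x 1 phi (dphi x).
Hypothesis cdp : continuous dphi.

Let cp : continuous phi.
Proof. exact: is_derive_continuous dp. Qed.

Let W w := rN * B w a b.
Let X c w := rN * B w a c.
Let bX c : bmf (X c). Proof. by apply: bmfM; [exact: bmf_cst|exact: bmf_entry]. Qed.
Let bW : bmf W. Proof. exact: bX. Qed.
Let bpW : bmf (fun w => phi (W w)). Proof. exact: bmf_comp. Qed.
Let bdW : bmf (fun w => dphi (W w)). Proof. exact: bmf_comp. Qed.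

Let bnd (k : R) x y : bounded_on_orthogonal (fun C : 'M[R]_n => k * C x y).
Proof.
exists `|k| => C oC; rewrite normrM ler_piMr//; exact: orthogonal_entry_le1.
Qed.

(** The row index [a] lies outside the plane [(b, c)], so the rotation acts on the row like a plane
    rotation of [(W, X c)]: at angle 0, [W] has derivative [X c] and [X c] has derivative [- W]. *)
Let offdiag_single c : c != a -> c != b ->
  E (fun w => - W w * phi (W w) + X c w ^+ 2 * dphi (W w)) = 0.
Proof.
move=> ca cb.
have bc : b != c by rewrite eq_sym.
have ac : a != c by rewrite eq_sym.
have := @Ex_rotation_product _ _ R P n B BB b c bc (fun C => rN * C a c)
  (fun C => rN * C a b) (fun C => - rN * C a b) (fun C => rN * C a c) phi dphi.
move=> H; rewrite -[RHS]H//.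
- by congr (Ex P _); apply/funext => w; rewrite /X /W; ring.
- by apply: measurable_funM => //; exact: mE.
- by apply: measurable_funM => //; exact: mE.
- move=> C; have -> : (fun t : R => rN * rconj b c t C a c) =
      fun t => cos t * (rN * C a c) + sin t * (- rN * C a b).
    by apply/funext => t; rewrite rconj_xj//; ring.
  exact: is_derive_trig1.
- move=> C; have -> : (fun t : R => rN * rconj b c t C a b) =
      fun t => cos t * (rN * C a b) + sin t * (rN * C a c).
    by apply/funext => t; rewrite rconj_xi//; ring.
  exact: is_derive_trig1.
Qed.

Lemma offdiag_identity :
  N * E (fun w => dphi (W w) - W w * phi (W w)) =
  E (fun w => (X a w ^+ 2 + W w ^+ 2) * dphi (W w) - 2 * (W w * phi (W w))).
Proof.
have bs c : bmf (fun w => - W w * phi (W w) + X c w ^+ 2 * dphi (W w)) by bmf_tac.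
have S0 : E (fun w => \sum_(c | (c != a) && (c != b))
    (- W w * phi (W w) + X c w ^+ 2 * dphi (W w))) = 0.
  by rewrite Ex_sum// big1// => c /andP[ca cb]; exact: offdiag_single.
rewrite -ExZ; last by bmf_tac.
apply/eqP; rewrite -subr_eq0 -ExB; [|by bmf_tac..].
rewrite -S0; apply/eqP; congr (Ex P _); apply/funext => w.
rewrite big_split/= sumr_const -mulr_suml.
have -> : \sum_(c | (c != a) && (c != b)) X c w ^+ 2 = N - X a w ^+ 2 - W w ^+ 2.
  have : \sum_c X c w ^+ 2 = N.
    rewrite /X; under eq_bigr do rewrite exprMn.
    by rewrite -mulr_sumr (orthogonal_row_norm a (oB w)) mulr1 expr2.
  rewrite (bigD1 a)//= (bigD1 b)/=; last by rewrite eq_sym.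
  by rewrite /W -/(X b w) => e; lra.
(* The sum has [N - 2] terms; the missing 2 produces the term [2 * (W * phi(W))]. *)
have -> : (N : R) = 2 + #|(fun c : 'I_n => (c != a) && (c != b))|%:R.
  rewrite -natrD; congr (_%:R).
  have := cardC (pred2 a b); rewrite card2 ab card_ord => e; rewrite -[LHS]e.
  by congr (_ + _)%N; apply: eq_card => c; rewrite !inE negb_or.
by rewrite -mulr_natl; ring.
Qed.

End offdiag.

Section diag.
Variables (a : 'I_n) (phi dphi : R -> R).
Hypothesis dp : forall x : R, is_derive x 1 phi (dphi x).
Hypothesis cdp : continuous dphi.

Let cp : continuous phi.
Proof. exact: is_derive_continuous dp. Qed.

Let W w := rN * B w a a.
Let bW : bmf W. Proof. by apply: bmfM; [exact: bmf_cst|exact: bmf_entry]. Qed.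
Let bpW : bmf (fun w => phi (W w)). Proof. exact: bmf_comp. Qed.
Let bdW : bmf (fun w => dphi (W w)). Proof. exact: bmf_comp. Qed.

Let bnd (k l : R) x y z t :
  bounded_on_orthogonal (fun C : 'M[R]_n => k * C x y + l * C z t).
Proof.
exists (`|k| + `|l|) => C oC; rewrite (le_trans (ler_normD _ _))// !normrM.
by rewrite lerD// ler_piMr//; exact: orthogonal_entry_le1.
Qed.

(** In the plane [(a, c)] the derivative of [W] at angle 0 is [rN * (B_ac + B_ca)]. Half of it is
    taken as the other factor, and its derivative is [rN * (B_cc - B_aa)], whose sum over [c] yields
    the trace. *)
Let diag_single c : c != a ->
  E (fun w => rN * (B w c c - B w a a) * phi (W w) +
     N / 2 * (B w a c + B w c a) ^+ 2 * dphi (W w)) = 0.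
Proof.
rewrite eq_sym => ac.
have := @Ex_rotation_product _ _ R P n B BB a c ac
  (fun C => rN / 2 * C a c + rN / 2 * C c a)
  (* The zero term gives this function the two-entry shape covered by [bnd]. *)
  (fun C => rN * C a a + 0 * C a a)
  (fun C => rN * C c c + - rN * C a a)
  (fun C => rN * C a c + rN * C c a) phi dphi.
move=> H; rewrite -[RHS]H//.
- congr (Ex P _); apply/funext => w; rewrite /W mul0r addr0.
  by have := rN2; move: (rN) => r <-; field.
- by apply: measurable_funD; apply: measurable_funM => //; exact: mE.
- by apply: measurable_funD; apply: measurable_funM => //; exact: mE.
- move=> C; have -> : (fun t : R => rN / 2 * rconj a c t C a c + rN / 2 * rconj a c t C c a) =
    fun t => cos t ^+ 2 * (rN / 2 * (C a c + C c a)) +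
      cos t * sin t * (rN * C c c + - rN * C a a) +
      sin t ^+ 2 * (- (rN / 2) * (C a c + C c a)).
    by apply/funext => t; rewrite rconj_ij// rconj_ji//; field.
  exact: is_derive_trig2.
- move=> C; have -> : (fun t : R => rN * rconj a c t C a a + 0 * rconj a c t C a a) =
    fun t => cos t ^+ 2 * (rN * C a a) + cos t * sin t * (rN * C a c + rN * C c a)
      + sin t ^+ 2 * (rN * C c c).
    by apply/funext => t; rewrite rconj_ii//; ring.
  exact: is_derive_trig2.
Qed.

Lemma diag_identity :
  N * E (fun w => dphi (W w) - W w * phi (W w)) =
  - E (fun w => rN * \tr (B w) * phi (W w)
     + N * ((B w *m B w) a a - 2 * B w a a ^+ 2) * dphi (W w)).
Proof.
have bE := bmf_entry; have bT := bmf_mxtrace.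
have bs c : bmf (fun w => rN * (B w c c - B w a a) * phi (W w) +
     N / 2 * (B w a c + B w c a) ^+ 2 * dphi (W w)) by bmf_tac.
have S0 : E (fun w => \sum_(c | c != a) (rN * (B w c c - B w a a) * phi (W w) +
     N / 2 * (B w a c + B w c a) ^+ 2 * dphi (W w))) = 0.
  by rewrite Ex_sum// big1// => c ca; exact: diag_single.
have bQ : bmf (fun w => (B w *m B w) a a).
  by under eq_fun do rewrite mxE; bmf_tac.
rewrite -ExZ; last by bmf_tac.
apply/eqP; rewrite -addr_eq0 -ExD; [|by bmf_tac..].
rewrite -S0; apply/eqP; congr (Ex P _); apply/funext => w.
rewrite big_split/= -!mulr_suml -!mulr_sumr.
have -> : \sum_(c | c != a) (B w c c - B w a a) = \tr (B w) - N * B w a a.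
  rewrite /mxtrace [in RHS](bigD1 a)//= sumrB sumr_const cardC1 card_ord.
  have -> : N = n.-1%:R + 1 :> R by rewrite natr1 prednK// (leq_ltn_trans _ (ltn_ord a)).
  by rewrite -mulr_natl; ring.
(* Over all [c], the squares contribute a row norm and a column norm, both 1, and the cross terms
   [2 * (B^2)_aa]; the term [c = a], equal to [4 * B_aa^2], is then removed. *)
have -> : \sum_(c | c != a) (B w a c + B w c a) ^+ 2 =
    2 * (1 + (B w *m B w) a a - 2 * B w a a ^+ 2).
  have e1 := orthogonal_row_norm a (oB w).
  have e2 := orthogonal_row_norm a (orthogonalT (oB w)).
  have : \sum_c (B w a c + B w c a) ^+ 2 = 2 + 2 * (B w *m B w) a a.
    transitivity (\sum_c B w a c ^+ 2 + \sum_c (B w)^T a c ^+ 2 +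
        2 * (B w *m B w) a a); last by rewrite e1 e2.
    rewrite mxE mulr_sumr -!big_split/=.
    by apply: eq_bigr => c _; rewrite mxE; ring.
  by rewrite (bigD1 a)//= => /(canRL (addKr _)) ->; ring.
by rewrite /W; have := rN2; move: (rN) => r <-; field.
Qed.

End diag.
End fixed_matrix.
End stein_identities.

(** * Error bounds in Stein's identity *)

Section stein_bounds.
Context {d : measure_display} {T : measurableType d} {R : realType}.
Variables (P : probability T R) (n : nat).
Local Notation mxT := (mxtype R n).
Local Notation N := (n%:R : R).
Local Notation rN := (Num.sqrt (n%:R : R)).
Local Notation E := (Ex P).

Let rN2 : rN * rN = N.
Proof. by rewrite -expr2 sqr_sqrtr. Qed.

Let id_derive (x : R) : is_derive x 1 (id : R -> R) ((fun=> 1) x).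
Proof. exact: is_derive_id. Qed.

Let cst1 : continuous ((fun=> 1) : R -> R).
Proof. by move=> x; exact: cvg_cst. Qed.

(** Squaring commutes with conjugation by an orthogonal matrix. This makes the second moment bound
    available for the entry [(B^2)_aa] too. *)
Lemma conj_invariant_sqr (B : T -> 'M[R]_n) :
  conj_invariant P B -> conj_invariant P (fun w => B w *m B w).
Proof.
move=> [mB oB iB].
have msq : measurable_fun setT (fun C : mxT => C *m C : mxT).
  have mid : measurable_fun setT (fun C : mxT => C) by exact: measurable_id.
  exact: (measurable_mulmx mid mid).
split.
- exact: (measurableT_comp msq mB).
- by move=> w; exact: orthogonalM.
move=> U oU A mA.
have mA' : mx_measurable ((fun C : mxT => C *m C) @^-1` A).
  by have := msq measurableT A mA; rewrite setTI.
have := iB U oU _ mA' => h; rewrite [LHS]h; congr (P _).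
apply/seteqP; split=> w /=;
  by rewrite !mulmxA -!(mulmxA _ U^T U) (orthogonal_trl oU) mulmx1 ?mulmxA.
Qed.

(** The diagonal identity with [phi = id]. Of the final 2, one unit is [E phi'] and the other bounds
    [(B^2)_aa]. *)
Lemma diag_second_moment (B : T -> 'M[R]_n) (a : 'I_n) : conj_invariant P B ->
  N * E (fun w => B w a a ^+ 2) <= E (fun w => `|\tr (B w)|) + 2.
Proof.
move=> BB.
have oB w : orthogonal_mx (B w) by case: BB.
have bE := bmf_entry BB; have bT := bmf_mxtrace BB.
have bQ := bmf_entry (conj_invariant_sqr BB).
have N0 : 0 < N by rewrite ltr0n (leq_ltn_trans _ (ltn_ord a)).
have := @diag_identity _ _ R P n B BB a id (fun=> 1) id_derive cst1.
set lhs := (X in N * E X); set rhs := (X in - E X).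
have -> : lhs = fun w => 1 - N * B w a a ^+ 2.
  by apply/funext => w; rewrite /lhs; have := rN2; move: (rN) => r <-; rewrite /=; ring.
have -> : rhs = fun w => N * (\tr (B w) * B w a a + (B w *m B w) a a - 2 * B w a a ^+ 2).
  by apply/funext => w; rewrite /rhs; have := rN2; move: (rN) => r <-; rewrite /=; ring.
rewrite ExZ; last by bmf_tac.
rewrite -mulrN => /(mulfI (lt0r_neq0 N0)).
rewrite ExB; [|by bmf_tac..]; rewrite Ex_cst ExZ; last by bmf_tac.
move=> h.
have : E (fun w => \tr (B w) * B w a a + (B w *m B w) a a - 2 * B w a a ^+ 2) <=
       E (fun w => `|\tr (B w)| + 1).
  apply: le_Ex; [by bmf_tac..|] => w.
  have h1 : \tr (B w) * B w a a <= `|\tr (B w)|.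
    rewrite (le_trans (ler_norm _))// normrM ler_piMr//.
    exact: orthogonal_entry_le1.
  have h2 : (B w *m B w) a a <= 1.
    rewrite (le_trans (ler_norm _))//; apply: orthogonal_entry_le1.
    exact: orthogonalM.
  have h3 := sqr_ge0 (B w a a).
  by lra.
rewrite [leRHS]ExD; [|by bmf_tac..]; rewrite Ex_cst; lra.
Qed.

Variable B : T -> 'M[R]_n.
Hypothesis BB : conj_invariant P B.
Hypothesis tr1 : E (fun w => `|\tr (B w)|) <= 1.
Hypothesis tr2 : E (fun w => `|\tr (B w *m B w)|) <= 2.

Let oB w : orthogonal_mx (B w). Proof. by case: BB. Qed.
Let bE := bmf_entry BB.
Let bT := bmf_mxtrace BB.
Let bQ := bmf_entry (conj_invariant_sqr BB).

Variables (phi dphi : R -> R) (K : R).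
Hypothesis dp : forall x : R, is_derive x 1 phi (dphi x).
Hypothesis cdp : continuous dphi.
Hypothesis pK : forall x, `|phi x| <= K.
Hypothesis dK : forall x, `|dphi x| <= K.

Let cp : continuous phi.
Proof. exact: is_derive_continuous dp. Qed.

Let K0 : 0 <= K. Proof. exact: le_trans (normr_ge0 _) (pK 0). Qed.

Let N_gt0 (a : 'I_n) : 0 < N.
Proof. by rewrite ltr0n (leq_ltn_trans _ (ltn_ord a)). Qed.

Let rN_ge1 (a : 'I_n) : 1 <= rN.
Proof.
by rewrite -[leLHS]sqrtr1 ler_sqrt// ler1n (leq_ltn_trans _ (ltn_ord a)).
Qed.

Lemma stein_bound_diag (a : 'I_n) :
  `|E (fun w => dphi (rN * B w a a) - rN * B w a a * phi (rN * B w a a))|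
     <= 10 * K / rN.
Proof.
have N0 := N_gt0 a; have r1 := rN_ge1 a.
have r0 : 0 < rN by exact: lt_le_trans r1.
have bW : bmf (fun w => rN * B w a a) by bmf_tac.
have bp : bmf (fun w => phi (rN * B w a a)) by exact: (bmf_comp cp bW).
have bd : bmf (fun w => dphi (rN * B w a a)) by exact: (bmf_comp cdp bW).
have e := diag_identity BB a dp cdp.
have m1 := diag_second_moment a BB.
have m2 := diag_second_moment a (conj_invariant_sqr BB).
rewrite -(ler_pM2l N0) -[X in X * `|_|](gtr0_norm N0) -normrM e normrN.
apply: le_trans (le_norm_Ex P _) _; first by bmf_tac.
have -> : N * (10 * K / rN) = 10 * K * rN.
  by have := rN2; move: (rN) r0 => r r0' <-; field; rewrite gt_eqF.
apply: (@le_trans _ _ (E (fun w => K * rN * `|\tr (B w)| +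
   K * (rN * (2^-1 + N / 2 * (B w *m B w) a a ^+ 2) + 2 * (N * B w a a ^+ 2))))).
  apply: le_Ex; [by bmf_tac..|] => w.
  rewrite (le_trans (ler_normD _ _))// lerD//.
    rewrite !normrM (gtr0_norm r0) [leLHS]mulrC -[leRHS]mulrA.
    by rewrite ler_wpM2r// mulr_ge0// ltW.
  rewrite normrM mulrC ler_pM//.
  rewrite normrM (gtr0_norm N0).
  (* AM-GM: [N |x| <= rN (1 + N x^2) / 2] *)
  apply: (@le_trans _ _ (N * (`|(B w *m B w) a a| + 2 * B w a a ^+ 2))).
    apply: ler_wpM2l; first exact: ltW.
    apply: le_trans (ler_normB _ _) _; rewrite lerD2l.
    by rewrite ger0_norm// mulr_ge0// sqr_ge0.
  rewrite mulrDr lerD//; last by rewrite mulrCA.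
  rewrite -real_normK ?num_real//.
  move: `|_| => x.
  have : 0 <= rN * (1 - rN * x) ^+ 2 by rewrite mulr_ge0 ?sqr_ge0 ?ltW.
  by have := rN2; move: (rN) => r <-; lra.
rewrite ExD; [|by bmf_tac..].
rewrite ExZ; [|by bmf_tac].
rewrite ExZ; [|by bmf_tac].
rewrite ExD; [|by bmf_tac..].
rewrite !ExZ; [|by bmf_tac..].
rewrite ExD; [|by bmf_tac..].
rewrite Ex_cst ExZ; [|by bmf_tac].
move: tr1 tr2 m1 m2.
set e1 := E (fun w => B w a a ^+ 2); set e2 := E (fun w => (B w *m B w) a a ^+ 2).
set t1 := E (fun w => `|\tr (B w)|); set t2 := E (fun w => `|\tr (B w *m B w)|).
move=> t1le t2le m1 m2.
have h1 : rN * t1 <= rN by rewrite ler_piMr// (ltW r0).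
have h2 : rN * (2^-1 + N / 2 * e2) <= rN * (5 / 2).
  by rewrite ler_wpM2l ?(ltW r0)//; lra.
(* The trace term gives [rN], the term with [(B^2)_aa] gives [5/2 * rN], and [N * e1 <= 3] gives 6;
   as [rN >= 1], the total is below [10 * rN]. *)
have h3 : rN * t1 + (rN * (2^-1 + N / 2 * e2) + 2 * (N * e1)) <= 10 * rN.
  move: h1 h2 r1; move: (rN * t1) (rN * (2^-1 + _)) => x y; lra.
rewrite [leLHS](_ : _ = K * (rN * t1 + (rN * (2^-1 + N / 2 * e2) + 2 * (N * e1)))); last first.
  by move: (rN) => r; ring.
by rewrite [leRHS](_ : _ = K * (10 * rN)) ?ler_wpM2l//; ring.
Qed.

Lemma stein_bound_offdiag (a b : 'I_n) : a != b ->
  `|E (fun w => dphi (rN * B w a b) - rN * B w a b * phi (rN * B w a b))|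
     <= 10 * K / rN.
Proof.
move=> ab.
have N0 := N_gt0 a; have r1 := rN_ge1 a.
have r0 : 0 < rN by exact: lt_le_trans r1.
have N2 : 2 <= N.
  rewrite ler_nat ltnNge; apply/negP => n1; move: ab; rewrite -val_eqE/=.
  have := ltn_ord a; have := ltn_ord b.
  by case: n n1 a b {N0 r1 r0} => [|[|]]// _ [[]]// ? [[]].
have bW : bmf (fun w => rN * B w a b) by bmf_tac.
have bp : bmf (fun w => phi (rN * B w a b)) by exact: (bmf_comp cp bW).
have bd : bmf (fun w => dphi (rN * B w a b)) by exact: (bmf_comp cdp bW).
have m1 := diag_second_moment a BB.
have eXa : E (fun w => (rN * B w a a) ^+ 2) = N * E (fun w => B w a a ^+ 2).
  rewrite -ExZ; last by bmf_tac.
  by congr (Ex P _); apply/funext => w; rewrite exprMn sqr_sqrtr.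
(* With [phi = id] the identity reads [(N - 1) * E W^2 = N - E X_a^2], where [X_a = rN * B_aa].
   Hence [E W^2 <= N / (N - 1) <= 2]. *)
have W2 : E (fun w => (rN * B w a b) ^+ 2) <= 2.
  have := offdiag_identity BB ab id_derive cst1.
  have -> : E (fun w => 1 - rN * B w a b * id (rN * B w a b)) =
            1 - E (fun w => (rN * B w a b) ^+ 2).
    rewrite -[X in X - _](Ex_cst P) -ExB; [|by bmf_tac..].
    by congr (Ex P _); apply/funext => w; rewrite expr2.
  have -> : E (fun w => ((rN * B w a a) ^+ 2 + (rN * B w a b) ^+ 2) * 1 -
      2 * (rN * B w a b * id (rN * B w a b))) =
     E (fun w => (rN * B w a a) ^+ 2) - E (fun w => (rN * B w a b) ^+ 2).
    rewrite -ExB; [|by bmf_tac..].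
    by congr (Ex P _); apply/funext => w; rewrite /=; ring.
  have : 0 <= E (fun w => (rN * B w a a) ^+ 2) by apply: Ex_ge0 => w; exact: sqr_ge0.
  move: (E _) (E _) => x y x0; nra.
have e := offdiag_identity BB ab dp cdp.
rewrite -(ler_pM2l N0) -[X in X * `|_|](gtr0_norm N0) -normrM e.
apply: le_trans (le_norm_Ex P _) _; first by bmf_tac.
have -> : N * (10 * K / rN) = 10 * K * rN.
  by have := rN2; move: (rN) r0 => r r0' <-; field; rewrite gt_eqF.
(* The integrand is at most [K * (X_a^2 + W^2 + 2 * |W|)], and [2 * |W| <= W^2 + 1]. *)
apply: (@le_trans _ _ (E (fun w => K * ((rN * B w a a) ^+ 2 +
    2 * (rN * B w a b) ^+ 2 + 1)))).
  apply: le_Ex; [by bmf_tac..|] => w.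
  move: (rN * B w a a) (rN * B w a b) => x y.
  apply: (le_trans (ler_normB _ _)); rewrite !normrM.
  have := pK y; have := dK y; have := normr_ge0 (phi y); have := normr_ge0 (dphi y).
  rewrite !(ger0_norm (sqr_ge0 _), @ger0_norm _ (x ^+ 2 + y ^+ 2)) ?addr_ge0 ?sqr_ge0//.
  rewrite (@ger0_norm _ 2)//.
  have : 0 <= (`|y| - 1) ^+ 2 by rewrite sqr_ge0.
  have := real_normK (num_real y); have := normr_ge0 y.
  have : 0 <= x ^+ 2 + y ^+ 2 by rewrite addr_ge0 ?sqr_ge0.
  move: (x ^+ 2) (y ^+ 2) `|y| `|phi y| `|dphi y| => X Y z p q XY z0 eY sq q0 p0 qK pK'.
  apply: (@le_trans _ _ ((X + Y) * K + 2 * (z * K))).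
    rewrite lerD// ?ler_wpM2l// ler_wpM2l//.
  have : 2 * z <= Y + 1 by rewrite -eY; nra.
  by move=> h; nra.
rewrite ExZ; [|by bmf_tac].
rewrite ExD; [|by bmf_tac..].
rewrite ExD; [|by bmf_tac..].
rewrite Ex_cst ExZ ?eXa; [|by bmf_tac..].
rewrite [leRHS](_ : _ = K * (10 * rN)); last by ring.
(* The moments add up to at most [3 + 4 + 1 = 8]. This is an error of order [1 / N], relaxed to the
   rate of the diagonal case. *)
apply: ler_wpM2l => //.
by move: W2 m1 tr1 r1; lra.
Qed.

Lemma stein_bound (a b : 'I_n) :
  `|E (fun w => dphi (rN * B w a b) - rN * B w a b * phi (rN * B w a b))|
     <= 10 * K / rN.
Proof.
by have [<-|ab] := eqVneq a b; [exact: stein_bound_diag|exact: stein_bound_offdiag].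
Qed.

End stein_bounds.

(** * Fixed points of permutations *)

Section permutation_counts.
Variable n : nat.
Implicit Types i j k : 'I_n.

(** Composing with a transposition shows that the count does not depend on [j], and the counts over
    all [j] add up to the number of permutations. *)
Lemma sum_perm_hit i j : (n * \sum_(p : {perm 'I_n}) (p i == j) = n`!)%N.
Proof.
have shift k : (\sum_(p : {perm 'I_n}) (p i == k) = \sum_(p : {perm 'I_n}) (p i == j))%N.
  rewrite (reindex_inj (mulIg (tperm j k))); apply: eq_bigr => p _.
  by rewrite permM -[X in _ == X](tpermL j k) (inj_eq perm_inj).
transitivity (\sum_(k < n) \sum_(p : {perm 'I_n}) (p i == k))%N.
  by under [RHS]eq_bigr do rewrite shift; rewrite sum_nat_const card_ord.
rewrite exchange_big/= -card_Sn -sum1_card.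
transitivity (\sum_(p : {perm 'I_n}) 1)%N; last by apply: eq_bigl => p; rewrite inE.
apply: eq_bigr => p _; rewrite (bigD1 (p i))//= eqxx big1 ?addn0// => k.
by rewrite eq_sym => /negbTE ->.
Qed.

Lemma sum_perm_fixed_points :
  (\sum_(p : {perm 'I_n}) \sum_(i < n) (p i == i) <= n`!)%N.
Proof.
rewrite exchange_big/=; case: (posnP n) => [n0|n0].
  by rewrite big1 ?fact_gt0// => i _; have := leq_ltn_trans (leq0n i) (ltn_ord i) => h;
     exfalso; move: h; rewrite n0.
rewrite -(leq_pmul2l n0) big_distrr/=.
under eq_bigr do rewrite sum_perm_hit.
by rewrite sum_nat_const card_ord.
Qed.

(** For fixed [i], split according to [j = p i]. The case [j = i] contributes at most [c i i]. For
    each of the [n - 1] other [j], the event [p j = i] is as frequent as [p j = k] for any [k != j],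
    hence has a share of at most [1 / (n - 1)] of [c i j = c i i]. *)
Lemma sum_perm_square_fixed_points :
  (\sum_(p : {perm 'I_n}) \sum_(i < n) (p (p i) == i) <= 2 * n`!)%N.
Proof.
rewrite exchange_big/=; case: (posnP n) => [n0|n0].
  by rewrite big1 ?muln_gt0 ?fact_gt0// => i _; have := leq_ltn_trans (leq0n i) (ltn_ord i) => h;
     exfalso; move: h; rewrite n0.
pose c i j := (\sum_(p : {perm 'I_n}) (p i == j))%N.
pose e i j k := (\sum_(p : {perm 'I_n}) (p i == j) * (p j == k))%N.
have cc i j : (n * c i j)%N = n`! by exact: sum_perm_hit.
have shift i j k : j != i -> k != j -> e i j k = e i j i.
  (* Exchanging the values [i] and [k] leaves the condition [p i = j] unchanged, because [j] is
     neither of them. *)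
  move=> ji kj; rewrite /e (reindex_inj (mulIg (tperm i k))).
  apply: eq_bigr => p _; rewrite !permM; congr (_ * _)%N.
    have tj : tperm i k j = j by rewrite tpermD// eq_sym.
    by rewrite -(inj_eq (@perm_inj _ (tperm i k)) (p i) j) tj.
  by rewrite -[X in _ == X](tpermL i k) (inj_eq perm_inj).
have ce i j : j != i -> (n.-1 * e i j i <= c i j)%N.
  move=> ji.
  have -> : (n.-1 * e i j i = \sum_(k | k != j) e i j k)%N.
    under eq_bigr => k kj do rewrite (shift i j k ji kj).
    by rewrite sum_nat_const cardC1 card_ord.
  rewrite /e exchange_big/=; apply: leq_sum => p _; rewrite -big_distrr/=.
  rewrite -[leqRHS]muln1 leq_mul2l; apply/orP; right.
  rewrite big_mkcond/= (bigD1 (p j))//= big1 ?addn0; last first.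
    by move=> k; rewrite eq_sym => /negbTE ->; case: ifP.
  by case: ifP => //; rewrite eqxx.
suff h i : (\sum_(p : {perm 'I_n}) (p (p i) == i) <= 2 * c i i)%N.
  rewrite -(leq_pmul2l n0) big_distrr/=.
  apply: (@leq_trans (\sum_(i < n) 2 * n`!)%N); last by rewrite sum_nat_const card_ord.
  by apply: leq_sum => i _; rewrite -(cc i i) mulnCA leq_mul2l h orbT.
have -> : (\sum_(p : {perm 'I_n}) (p (p i) == i) = \sum_j e i j i)%N.
  rewrite /e exchange_big/=; apply: eq_bigr => p _.
  rewrite (bigD1 (p i))//= eqxx mul1n big1 ?addn0// => j.
  by rewrite eq_sym => /negbTE ->.
rewrite (bigD1 i)//= mul2n -addnn leq_add//.
  by apply: leq_sum => p _; rewrite -[leqRHS]muln1 leq_mul2l leq_b1 orbT.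
(* For [n = 1] there is no [j != i], and [n.-1] cannot be cancelled. *)
case: (posnP n.-1) => [n1|n1].
  rewrite big1// => j ji; exfalso; move: ji; rewrite -val_eqE/=.
  have n_1 : n = 1%N by rewrite -(prednK n0) n1.
  have lt1 (k : 'I_n) : (k < 1)%N.
    exact: (eq_ind n (fun m => (k < m)%N) (ltn_ord k) 1%N n_1).
  by have := lt1 i; have := lt1 j; rewrite !ltnS !leqn0 => /eqP -> /eqP ->.
rewrite -(leq_pmul2l n1) big_distrr/=.
apply: (@leq_trans (\sum_(j < n | j != i) c i j)%N).
  by apply: leq_sum => j ji; exact: ce.
have cij j : c i j = c i i.
  by apply/eqP; rewrite -(eqn_pmul2l n0) !cc.
by under eq_bigr do rewrite cij; rewrite sum_nat_const cardC1 card_ord.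
Qed.

End permutation_counts.

(** * Haar conjugates of permutation matrices *)

Section haar_conjugation.
Context {d : measure_display} {T : measurableType d} {R : realType}.
Variables (P : probability T R) (n : nat).
Local Notation mxT := (mxtype R n).

Lemma probability_eq_off_null (A B Z : set T) :
  measurable A -> measurable B -> measurable Z -> P Z = 0%E ->
  (forall w, ~ Z w -> A w <-> B w) -> P A = P B.
Proof.
move=> mA mB mZ Z0 AB.
have le (X Y : set T) : measurable X -> measurable Y ->
    (forall w, ~ Z w -> X w -> Y w) -> (P X <= P Y)%E.
  move=> mX mY XY; apply: (@le_trans _ _ (P (Y `|` Z))).
    apply: le_measure; rewrite ?inE//; first exact: measurableU.
    by move=> w Xw; have [Zw|Zw] := pselect (Z w); [right|left; exact: XY].
  apply: (le_trans (measureU2 _ mY mZ)).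
  by rewrite [X in (_ + X)%E]Z0 adde0.
by apply/eqP; rewrite eq_le !le// => w /AB[].
Qed.

(** Orthogonality is given almost surely only. Resetting [M] to the identity on a null set makes it
    hold everywhere, as [conj_invariant] demands, and changes no probability. *)
Lemma haar_orthogonal_everywhere (M : T -> 'M[R]_n) (s : T -> {perm 'I_n}) :
  haar_orthogonal_rv P M -> uniform_perm_rv P s -> indep_mx_perm P M s ->
  exists M' : T -> 'M[R]_n, exists Z : set T,
    [/\ haar_orthogonal_rv P M', indep_mx_perm P M' s,
        forall w, orthogonal_mx (M' w),
        measurable Z /\ P Z = 0%E & forall w, ~ Z w -> M' w = M w].
Proof.
move=> [mM [Z [mZ Z0 oM]] iM] us ind.
pose M' w := if pselect (Z w) then 1%:M else M w.
have MM w : ~ Z w -> M' w = M w by rewrite /M'; case: pselect.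
have oM' w : orthogonal_mx (M' w).
  rewrite /M'; case: pselect => [z|nZ] /=; first by apply/eqP; rewrite trmx1 mulmx1.
  by apply/negPn/negP => no; apply/nZ/oM; exact/negP.
have mM1 : measurable_fun setT (M : T -> mxT) by move=> _ A mA; rewrite setTI; exact: mM.
(* A general [f] covers [M'] itself as well as its left and right multiples by a fixed orthogonal
   matrix. *)
have mfix (f : mxT -> mxT) : measurable_fun setT f ->
    forall A, mx_measurable A -> measurable ((fun w => f (M' w)) @^-1` A).
  move=> mf A mA.
  have mfA : mx_measurable (f @^-1` A) by have := mf measurableT A mA; rewrite setTI.
  have -> : (fun w => f (M' w)) @^-1` A =
      ((M @^-1` (f @^-1` A)) `&` ~` Z) `|` (Z `&` [set w | A (f 1%:M)]).
    apply/seteqP; split => w /=.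
      have [Zw|Zw] := pselect (Z w); last by rewrite MM//; left.
      by rewrite /M'; case: pselect => //= z ?; right.
    case=> [[Aw Zw]|[Zw Aw]]; first by rewrite MM.
    by rewrite /M'; case: pselect.
  apply: measurableU.
    by apply: measurableI; [exact: mM|exact: measurableC].
  apply: measurableI => //.
  have [h|h] := pselect (A (f 1%:M)).
    by rewrite (_ : [set _ | _] = setT)//; apply/seteqP; split.
  by rewrite (_ : [set _ | _] = set0)//; apply/seteqP; split.
have mid : measurable_fun setT (fun C : mxT => C) by exact: measurable_id.
have mcst (U : 'M[R]_n) : measurable_fun setT ((fun=> U) : mxT -> mxT).
  exact: measurable_cst.
have mfixM (f : mxT -> mxT) : measurable_fun setT f ->
    forall A, mx_measurable A -> measurable ((fun w => f (M w)) @^-1` A).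
  move=> mf A mA; apply: (mM (f @^-1` A)).
  by have := mf measurableT A mA; rewrite setTI.
have mM' A : mx_measurable A -> measurable (M' @^-1` A) by exact: (mfix _ mid).
have PM (f : mxT -> mxT) A : measurable_fun setT f -> mx_measurable A ->
    P ((fun w => f (M' w)) @^-1` A) = P ((fun w => f (M w)) @^-1` A).
  move=> mf mA; apply: (@probability_eq_off_null _ _ Z) => //.
  - exact: mfix.
  - exact: mfixM.
  - by move=> w Zw /=; rewrite MM.
have PM0 A : mx_measurable A -> P (M' @^-1` A) = P (M @^-1` A).
  exact: (PM _ A mid).
exists M', Z; split => //.
- split => //; first exact: aeW.
  move=> U oU A mA; have [h1 h2] := iM U oU A mA.
  have mU := mcst U.
  have mL := measurable_mulmx mU mid; have mR := measurable_mulmx mid mU.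
  split.
    by rewrite (PM0 A mA) h1; exact: esym (PM _ A mL mA).
  by rewrite (PM0 A mA) h2; exact: esym (PM _ A mR mA).
- move=> A mA p; rewrite (PM0 A mA) -(ind A mA p).
  apply: (@probability_eq_off_null _ _ Z) => //.
  - by apply: measurableI; [exact: mM'|case: (us p)].
  - by apply: measurableI; [exact: mM|case: (us p)].
  - by move=> w Zw /=; rewrite MM.
Qed.

Section conjugated_permutation.
Variables (M : T -> 'M[R]_n) (s : T -> {perm 'I_n}).
Hypothesis hM : haar_orthogonal_rv P M.
Hypothesis us : uniform_perm_rv P s.

Let ms p : measurable [set w | s w = p]. Proof. by case: (us p). Qed.

Let sum_indic_perm (f : {perm 'I_n} -> R) w :
  f (s w) = \sum_p f p * \1_[set w | s w = p] w.
Proof.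
rewrite (bigD1 (s w))//= indicE mem_set// mulr1 big1 ?addr0// => p ps.
rewrite indicE memNset ?mulr0// => /= e.
by move: ps; rewrite e eqxx.
Qed.

Lemma Ex_uniform_perm (f : {perm 'I_n} -> R) :
  Ex P (fun w => f (s w)) = (n`!%:R)^-1 * \sum_p f p.
Proof.
under eq_fun do rewrite sum_indic_perm.
rewrite Ex_sum => [|p]; last by apply: bmfM; [exact: bmf_cst|exact: bmf_indic].
rewrite mulr_sumr; apply: eq_bigr => p _; rewrite ExZ; last exact: bmf_indic.
by rewrite Ex_indic//; have [_ ->] := us p; rewrite mulrC.
Qed.

Definition conj_perm w := M w *m perm_mx (s w) *m (M w)^T.

Let mM : measurable_fun setT (M : T -> mxT).
Proof. by move=> _ A mA; rewrite setTI; case: hM => h _ _; exact: h. Qed.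

Let mperm : measurable_fun setT ((fun w => perm_mx (s w)) : T -> mxT).
Proof.
apply: measurable_mx => i j.
under eq_fun do rewrite (sum_indic_perm (fun p => (perm_mx p : 'M[R]_n) i j)).
apply: measurable_sum => p; apply: measurable_funM; first exact: measurable_cst.
exact: measurable_indic.
Qed.

Lemma measurable_conj_perm : measurable_fun setT (conj_perm : T -> mxT).
Proof.
exact: (measurable_mulmx (measurable_mulmx mM mperm) (measurable_trmx mM)).
Qed.

Hypothesis oM : forall w, orthogonal_mx (M w).
Hypothesis ind : indep_mx_perm P M s.

(** Conjugating [M p M^T] by [U] replaces [M] with [U M]. So one splits over the values [p] of the
    permutation, factors by independence, and uses the left invariance of the law of [M] for each
    [p]. *)
Lemma conj_invariant_conj_perm : conj_invariant P conj_perm.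
Proof.
have mconj := measurable_conj_perm.
split => //.
  by move=> w; apply: orthogonal_conj => //; exact: orthogonal_perm.
move=> U oU A mA.
have mconjU : measurable_fun setT (fun w => U *m conj_perm w *m U^T : mxT).
  have mU : measurable_fun setT ((fun=> U) : T -> mxT) by exact: measurable_cst.
  exact: (measurable_mulmx (measurable_mulmx mU mconj) (measurable_trmx mU)).
have mid : measurable_fun setT (fun C : mxT => C) by exact: measurable_id.
have mcst (V : 'M[R]_n) : measurable_fun setT ((fun=> V) : mxT -> mxT).
  exact: measurable_cst.
have split_perm (F : T -> 'M[R]_n) : measurable_fun setT (F : T -> mxT) ->
    fine (P (F @^-1` A)) = \sum_p fine (P (F @^-1` A `&` [set w | s w = p])).
  move=> mF.
  have mFA : measurable (F @^-1` A) by have := mF measurableT A mA; rewrite setTI.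
  rewrite -Ex_indic//.
  have -> : \1_(F @^-1` A) = fun w => \sum_p \1_(F @^-1` A `&` [set w | s w = p]) w :> R.
    apply/funext => w; rewrite [LHS](_ : _ = \sum_p \1_(F @^-1` A) w *
        \1_[set w | s w = p] w); last exact: (sum_indic_perm (fun=> _)).
    by apply: eq_bigr => p _; rewrite indicI.
  rewrite Ex_sum => [|p]; last by apply: bmf_indic; exact: measurableI.
  by apply: eq_bigr => p _; rewrite Ex_indic//; exact: measurableI.
suff h : fine (P (conj_perm @^-1` A)) =
    fine (P ((fun w => U *m conj_perm w *m U^T) @^-1` A)).
  have m1 : measurable (conj_perm @^-1` A) by have := mconj measurableT A mA; rewrite setTI.
  have m2 : measurable ((fun w => U *m conj_perm w *m U^T) @^-1` A).
    by have := mconjU measurableT A mA; rewrite setTI.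
  have := congr1 EFin h; rewrite !fineK//; exact: fin_num_measure.
rewrite !split_perm//; apply: eq_bigr => p _; congr fine.
pose f : mxT -> mxT := fun C => C *m perm_mx p *m C^T.
have mf : measurable_fun setT f.
  exact: (measurable_mulmx (measurable_mulmx mid (mcst (perm_mx p))) (measurable_trmx mid)).
have mUC : measurable_fun setT (fun C : mxT => U *m C : mxT).
  exact: (measurable_mulmx (mcst U) mid).
have mfA : mx_measurable (f @^-1` A) by have := mf measurableT A mA; rewrite setTI.
have mfUA : mx_measurable ((fun C : mxT => U *m C) @^-1` (f @^-1` A)).
  by have := mUC measurableT _ mfA; rewrite setTI.
transitivity (P (M @^-1` (f @^-1` A) `&` [set w | s w = p])).
  by congr (P _); apply/seteqP; split => w /= [+ e]; rewrite /conj_perm /f e.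
transitivity (P (M @^-1` ((fun C : mxT => U *m C) @^-1` (f @^-1` A))
    `&` [set w | s w = p])).
  rewrite [LHS](ind mfA p) [RHS](ind mfUA p); congr (_ * _)%E.
  by case: hM => _ _ /(_ U oU _ mfA) [].
congr (P _); apply/seteqP; split => w /= [+ e];
  by rewrite /conj_perm /f e trmx_mul !mulmxA.
Qed.

Let trace_perm p : \tr (perm_mx p : 'M[R]_n) = (\sum_(i < n) (p i == i))%:R.
Proof. by rewrite natr_sum; apply: eq_bigr => i _; rewrite !mxE. Qed.

Let fact_pos : (0 : R) < n`!%:R. Proof. by rewrite ltr0n fact_gt0. Qed.

(** The trace is invariant under conjugation and counts the fixed points of the permutation. It is
    therefore nonnegative, and its mean is a count over the symmetric group. *)
Lemma Ex_trace_conj_perm : Ex P (fun w => `|\tr (conj_perm w)|) <= 1.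
Proof.
pose f (p : {perm 'I_n}) : R := (\sum_(i < n) (p i == i))%:R.
have -> : (fun w => `|\tr (conj_perm w)|) =
    fun w => f (s w).
  apply/funext => w; rewrite /conj_perm mxtrace_mulC mulmxA orthogonal_trl//.
  by rewrite mul1mx trace_perm ger0_norm.
rewrite Ex_uniform_perm -natr_sum ler_pdivrMl// mulr1 ler_nat.
exact: sum_perm_fixed_points.
Qed.

Lemma Ex_trace_conj_perm_sqr :
  Ex P (fun w => `|\tr (conj_perm w *m conj_perm w)|) <= 2.
Proof.
pose f (p : {perm 'I_n}) : R := (\sum_(i < n) (p (p i) == i))%:R.
have -> : (fun w => `|\tr (conj_perm w *m conj_perm w)|) =
    fun w => f (s w).
  apply/funext => w; rewrite /conj_perm !mulmxA.
  rewrite -(mulmxA _ (M w)^T (M w)) orthogonal_trl// mulmx1.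
  rewrite mxtrace_mulC !mulmxA orthogonal_trl// mul1mx -perm_mxM trace_perm.
  by rewrite ger0_norm//; congr (_%:R); apply: eq_bigr => i _; rewrite permM.
rewrite Ex_uniform_perm -natr_sum ler_pdivrMl// -natrM ler_nat mulnC.
exact: sum_perm_square_fixed_points.
Qed.

End conjugated_permutation.
End haar_conjugation.

(** * Convergence of the distribution functions *)

Section cdf_bounds.
Context {d : measure_display} {T : measurableType d} {R : realType}.
Variables (P : probability T R) (n : nat).
Local Notation rN := (Num.sqrt (n%:R : R)).
Variables (M : T -> 'M[R]_n) (s : T -> {perm 'I_n}).
Hypothesis hM : haar_orthogonal_rv P M.
Hypothesis us : uniform_perm_rv P s.
Hypothesis ind : indep_mx_perm P M s.
Variables (h phi : R -> R) (K : R).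
Hypothesis ch : continuous h.
Hypothesis h01 : forall y, 0 <= h y <= 1.
Hypothesis dphi : forall y : R, is_derive y 1 phi (y * phi y + (h y - gauss_mean h)).
Hypothesis phiK : forall y, `|phi y| <= K.
Hypothesis dphiK : forall y, `|y * phi y + (h y - gauss_mean h)| <= K.

Let cphi : continuous phi.
Proof. exact: is_derive_continuous dphi. Qed.

Let cdphi : continuous (fun y : R => y * phi y + (h y - gauss_mean h)).
Proof.
move=> y; apply: cvgD; first by apply: cvgM; [exact: cvg_id|exact: cphi].
by apply: cvgB; [exact: ch|exact: cvg_cst].
Qed.

(** By Stein's equation, [stein_bound] reads [|E h(W) - E h(Z)| <= 10 * K / rN]. The two conditions
    on [h] make it a majorant, respectively a minorant, of the indicator of the half-line. *)
Lemma conj_perm_smooth_cdf (a b : 'I_n) (x : R) :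
  let F := fine (P [set w | rN * conj_perm M s w a b <= x]) in
  ((forall y, y <= x -> h y = 1) -> F <= gauss_mean h + 10 * K / rN) /\
  ((forall y, x < y -> h y = 0) -> gauss_mean h - 10 * K / rN <= F).
Proof.
have [M' [Z [hM' ind' oM' [mZ Z0] MM]]] := haar_orthogonal_everywhere hM us ind.
have mlevel M1 : haar_orthogonal_rv P M1 ->
    measurable [set w | rN * conj_perm M1 s w a b <= x].
  move=> hM1.
  have mW : measurable_fun setT (fun w => rN * conj_perm M1 s w a b).
    apply: measurable_funM; first exact: measurable_cst.
    exact: (measurableT_comp (measurable_entry a b) (measurable_conj_perm hM1 us)).
  have := mW measurableT `]-oo, x]%classic (measurable_itv _).
  by rewrite setTI; congr (measurable _); apply/seteqP; split => w /=; rewrite in_itv.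
rewrite (@probability_eq_off_null _ _ _ P _ [set w | rN * conj_perm M' s w a b <= x] Z)//.
- move=> F.
  have BB := conj_invariant_conj_perm hM' us oM' ind'.
  have bW : bmf (fun w => rN * conj_perm M' s w a b).
    by apply: bmfM; [exact: bmf_cst|exact: (bmf_entry BB)].
  have bh : bmf (fun w => h (rN * conj_perm M' s w a b)) by exact: (bmf_comp ch bW).
  have mF := mlevel M' hM'.
  have := stein_bound BB (Ex_trace_conj_perm us oM') (Ex_trace_conj_perm_sqr us oM')
    dphi cdphi phiK dphiK a b.
  have -> : Ex P (fun w => rN * conj_perm M' s w a b * phi (rN * conj_perm M' s w a b) +
      (h (rN * conj_perm M' s w a b) - gauss_mean h) -
      rN * conj_perm M' s w a b * phi (rN * conj_perm M' s w a b)) =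
      Ex P (fun w => h (rN * conj_perm M' s w a b)) - gauss_mean h.
    rewrite -[X in _ = _ - X](Ex_cst P) -ExB//; last exact: bmf_cst.
    by congr (Ex P _); apply/funext => w; rewrite addrAC subrr add0r.
  rewrite ler_norml => /andP[lo hi]; rewrite /F -Ex_indic//; split=> hx.
    apply: (@le_trans _ _ (Ex P (fun w => h (rN * conj_perm M' s w a b)))); last by lra.
    apply: le_Ex => //; first exact: bmf_indic.
    move=> w; rewrite indicE; case: (boolP (w \in _)) => [/set_mem/= wx|_]; first by rewrite hx.
    by have /andP[] := h01 (rN * conj_perm M' s w a b).
  apply: (@le_trans _ _ (Ex P (fun w => h (rN * conj_perm M' s w a b)))); first by lra.
  apply: le_Ex => //; first exact: bmf_indic.
  move=> w; rewrite indicE; case: (boolP (w \in _)) => [_|/negP wx].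
    by have /andP[] := h01 (rN * conj_perm M' s w a b).
  by rewrite hx// ltNge; apply/negP => le; apply: wx; exact: mem_set.
- exact: mlevel.
- exact: mlevel.
- by move=> w Zw /=; rewrite /conj_perm MM.
Qed.

End cdf_bounds.

(** * Piecewise linear approximations of half-lines *)

Section ramp.
Context {R : realType}.
Local Notation mu := (@lebesgue_measure R).
Local Notation pdf := (@normal_pdf R 0 1).
Implicit Types x y e : R.

(** For [u = (x + e - y) / e] this is [u] clamped to the interval from 0 to 1: for [e > 0] it
    descends from 1 at [x] to 0 at [x + e]. Absolute values make continuity immediate. *)
Definition ramp x e y := (`|(x + e - y) / e| - `|(x + e - y) / e - 1| + 1) / 2.

Lemma continuous_ramp x e : continuous (ramp x e).
Proof.
have c0 : continuous (fun y => (x + e - y) / e).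
  move=> y; apply: cvgM; last exact: cvg_cst.
  by apply: cvgB; [exact: cvg_cst|exact: cvg_id].
move=> y; apply: cvgM; last exact: cvg_cst.
apply: cvgD; last exact: cvg_cst.
apply: cvgB; apply: cvg_norm; first exact: c0.
by apply: cvgB; [exact: c0|exact: cvg_cst].
Qed.

Lemma ramp01 x e y : 0 <= ramp x e y <= 1.
Proof.
rewrite /ramp; move: (_ / e) => u.
by case: (ger0P u) => u0; case: (ger0P (u - 1)) => u1; lra.
Qed.

Lemma ramp1 x e y : 0 < e -> y <= x -> ramp x e y = 1.
Proof.
move=> e0 yx; have u1 : 1 <= (x + e - y) / e by rewrite ler_pdivlMr//; lra.
rewrite /ramp; move: (_ / e) u1 => u u1.
by rewrite !ger0_norm; [field|lra..].
Qed.

Lemma ramp0 x e y : 0 < e -> x + e <= y -> ramp x e y = 0.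
Proof.
move=> e0 yx; have u0 : (x + e - y) / e <= 0 by rewrite ler_pdivrMr// mul0r; lra.
rewrite /ramp; move: (_ / e) u0 => u u0.
by rewrite !ler0_norm; [field|lra..].
Qed.

Definition gauss_cdf x := \int[mu]_(y in `]-oo, x]) pdf y.

Lemma gauss_cdfE x : fine (normal_prob 0 1 [set y : R | y <= x]) = gauss_cdf x.
Proof. by rewrite -set_itvNyc. Qed.

Lemma continuous_gauss_cdf : continuous gauss_cdf.
Proof.
move=> x; apply: differentiable_continuous; apply/derivable1_diffP.
have x1 : x < x + 1 by rewrite ltrDl.
have cp : {for x, continuous pdf} by apply: continuous_normal_pdf; exact: oner_neq0.
by have [] := @continuous_FTC1 R pdf -oo%O x (x + 1) x1
  (integrable_pdf01 (measurable_itv _)) (ltNyr _) cp.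
Qed.

Let integrable_ramp x e : mu.-integrable setT (EFin \o (fun y => ramp x e y * pdf y)).
Proof.
apply: le_integrable (integrable_pdf01 measurableT) => //.
  apply/measurable_EFinP/measurable_funM; last exact: measurable_normal_pdf.
  by apply: continuous_measurable_fun; exact: continuous_ramp.
move=> y _ /=; rewrite lee_fin normrM ler_piMl//.
by have /andP[h0 h1] := ramp01 x e y; rewrite ger0_norm.
Qed.

Let integrable_half x : mu.-integrable setT (EFin \o (pdf \_ `]-oo, x])).
Proof.
rewrite -restrict_EFin; apply/integrable_restrict => //=.
by rewrite setTI; exact: integrable_pdf01.
Qed.

Lemma gauss_mean_ramp_le x e : 0 < e -> gauss_mean (ramp x e) <= gauss_cdf (x + e).
Proof.
move=> e0; rewrite /gauss_cdf Rintegral_mkcond; apply: le_Rintegral => //.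
move=> y _; rewrite patchE; case: ifPn => [_|].
  by rewrite ler_piMl ?normal_pdf_ge0//; have /andP[] := ramp01 x e y.
by rewrite notin_setE/= in_itv/= => /negP; rewrite -ltNge => xy;
   rewrite ramp0 ?mul0r// ltW.
Qed.

Lemma gauss_cdf_le_mean_ramp x e : 0 < e -> gauss_cdf x <= gauss_mean (ramp x e).
Proof.
move=> e0; rewrite /gauss_cdf Rintegral_mkcond; apply: le_Rintegral => //.
move=> y _; rewrite patchE; case: ifPn => [|_].
  by rewrite inE/= in_itv/= => yx; rewrite ramp1 ?mul1r.
by rewrite mulr_ge0 ?normal_pdf_ge0//; have /andP[] := ramp01 x e y.
Qed.

End ramp.

Lemma cvg_invr_sqrt (R : realType) (K : R) :
  (fun n : nat => K / Num.sqrt (n.+1%:R : R)) @ \oo --> (0 : R).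
Proof.
rewrite -(mulr0 K); apply: cvgMr.
rewrite (_ : (fun n => _) = fun n => Num.sqrt (@harmonic R n)); last first.
  by apply/funext => n; rewrite /harmonic sqrtrV.
rewrite -sqrtr0; apply: continuous_cvg; first exact: sqrt_continuous.
exact: cvg_harmonic.
Qed.

Unset Implicit Arguments.

(* Dimension is indexed as n.+1 (n : nat); entries (a,b) are read via inord,
   which is the true entry (a,b) as soon as a, b <= n. Convergence in
   distribution to N(0,1) = pointwise convergence of the CDFs (the limit CDF
   is continuous everywhere). *)
Theorem theorem2p6 (R : realType) (a b : nat)
    (d : nat -> measure_display) (T : forall n, measurableType (d n))
    (P : forall n, probability (T n) R)
    (M : forall n, T n -> 'M[R]_n.+1) (s : forall n, T n -> {perm 'I_n.+1}) :
  (forall n, haar_orthogonal_rv (P n) (M n)) ->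
  (forall n, uniform_perm_rv (P n) (s n)) ->
  (forall n, indep_mx_perm (P n) (M n) (s n)) ->
  forall x : R,
    (fun n : nat => fine (P n [set w | Num.sqrt (n.+1)%:R *
        (M n w *m perm_mx (s n w) *m (M n w)^T) (inord a) (inord b) <= x]))
      @ \oo --> fine (normal_prob 0 1 [set y : R | y <= x]).
Proof.
move=> hM us ind x; rewrite gauss_cdfE.
apply/cvgrPdist_le => /= eps eps0.
have e20 : 0 < eps / 2 by rewrite divr_gt0.
have [/= r r0 rP] : \forall y \near x, `|gauss_cdf x - gauss_cdf y| <= eps / 2.
  by have /cvgrPdist_le := @continuous_gauss_cdf R x; apply.
(* Half the radius, since the neighbourhood of [x] is an open ball and [x + e], [x - e] must lie
   inside it. *)
pose e := r / 2.
have e0 : 0 < e by rewrite divr_gt0.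
have er : e < r by rewrite ltr_pdivrMr// ltr_pMr// ltr1n.
have hi : `|gauss_cdf x - gauss_cdf (x + e)| <= eps / 2.
  by apply: rP; rewrite /= opprD addNKr normrN gtr0_norm.
have lo : `|gauss_cdf x - gauss_cdf (x - e)| <= eps / 2.
  by apply: rP; rewrite /= opprB addrC subrK gtr0_norm.
(* The ramp descending after [x] serves the upper bound, the one descending before [x] the lower
   bound. The constants [K1] and [K2] depend on [e] but not on [n], so the Stein errors tend to
   0. *)
have [f1 [K1 [d1 b1 db1]]] := stein_solution (@continuous_ramp R x e) (ramp01 x e).
have [f2 [K2 [d2 b2 db2]]] :=
  stein_solution (@continuous_ramp R (x - e) e) (ramp01 (x - e) e).
have near1 : \forall n \near \oo, 10 * K1 / Num.sqrt (n.+1%:R : R) <= eps / 2.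
  have /cvgrPdist_le/(_ _ e20) := cvg_invr_sqrt (10 * K1).
  by apply: filterS => n; rewrite sub0r normrN; apply: le_trans (ler_norm _).
have near2 : \forall n \near \oo, 10 * K2 / Num.sqrt (n.+1%:R : R) <= eps / 2.
  have /cvgrPdist_le/(_ _ e20) := cvg_invr_sqrt (10 * K2).
  by apply: filterS => n; rewrite sub0r normrN; apply: le_trans (ler_norm _).
near=> n.
have k1 : 10 * K1 / Num.sqrt (n.+1%:R : R) <= eps / 2 by near: n.
have k2 : 10 * K2 / Num.sqrt (n.+1%:R : R) <= eps / 2 by near: n.
have [up _] := conj_perm_smooth_cdf (hM n) (us n) (ind n)
  (@continuous_ramp R x e) (ramp01 x e) d1 b1 db1 (inord a) (inord b) x.
have [_ dn] := conj_perm_smooth_cdf (hM n) (us n) (ind n)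
  (@continuous_ramp R (x - e) e) (ramp01 (x - e) e) d2 b2 db2 (inord a) (inord b) x.
have {}up := up (fun y => @ramp1 R x e y e0).
have hz (y : R) : x < y -> ramp (x - e) e y = 0.
  by move=> xy; rewrite ramp0// subrK ltW.
have {}dn := dn hz.
have g1 := gauss_mean_ramp_le x e0.
have g2 := gauss_cdf_le_mean_ramp (x - e) e0.
move: hi lo up dn; rewrite /conj_perm !ler_norml.
move=> /andP[hi1 hi2] /andP[lo1 lo2] up dn.
(* The distribution function at [x] lies between [gauss_cdf (x - e) - eps / 2] and
   [gauss_cdf (x + e) + eps / 2]; continuity of [gauss_cdf] accounts for the other half of [eps]. *)
by apply/andP; split; lra.
Unshelve. all: end_near. Qed.
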